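(* Let $H$ be a definite Hamiltonian on $(a,b)$. Further, let $r_0\ge 0$, $c_-,c_+>0$, assume that $(\hat t,\hat s)$ is a compatible pair for $H,r_0$ with constants $c_-,c_+$, and let $K_H(t;r)$ be the kernel defined below. Then, for $x\in\operatorname{dom}H$, \[ \log|w_{H,22}(x;ir)| \asymp \int_a^x K_H(t;r)\,\mathrm{d}t, \qquad r>r_0. \] The constants implicit in the relation `$\asymp$' depend on $c_-,c_+$ but not on $H,x,r_0,\hat t,\hat s$.
   Context: Let $-\infty<a<b\le\infty$. A Hamiltonian on $(a,b)$ is a measurable function $H:(a,b)\to\mathbb{R}^{2\times 2}$ with $H\in L^1((a,c),\mathbb{R}^{2\times2})$ for all $c\in(a,b)$, $H(t)\ge 0$ for a.e. $t$, and $\{t:H(t)=0\}$ of measure zero; write $H=\begin{pmatrix}h_1&h_3\\ h_3&h_2\end{pmatrix}$. $\operatorname{dom}H:=[a,b]$ if $\int_a^b\operatorname{tr}H<\infty$ (limit circle case) and $[a,b)$ otherwise. With $\xi_\phi:=(\cos\phi,\sin\phi)^T$, $H$ is definite if there is no $\phi$ with $H(t)=\operatorname{tr}H(t)\,\xi_\phi\xi_\phi^T$ for a.e. $t\in(a,b)$. Set $\Omega(s,t):=\int_s^tH(u)\,\mathrm{d}u$ and $\omega_j(s,t):=\int_s^t h_j(u)\,\mathrm{d}u$. A compatible pair $(\hat t,\hat s)$ for $H,r_0$ with constants $c_-,c_+$ consists of $\hat t:(r_0,\infty)\to(a,b)$ with $\frac{c_-}{r^2}\le\det\Omega(a,\hat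 t(r))\le\frac{c_+}{r^2}$, and $\hat s$ defined on $\{(t,r)\in(a,b)\times(r_0,\infty): t\ge\hat t(r)\}$ with values in $[a,b)$, $\hat s(t;r)\le t$ and $\frac{c_-}{r^2}\le\det\Omega(\hat s(t;r),t)\le\frac{c_+}{r^2}$. The kernel is \[ K_H(t;r):=\mathbf{1}_{[a,\hat t(r))}(t)\frac{\omega_2(a,t)h_1(t)}{\frac{c_+}{r^2}+(\omega_3(a,t))^2}+\mathbf{1}_{[\hat t(r),b)}(t)\frac{h_1(t)}{\omega_1(\hat s(t;r),t)}. \] $W_H(t;z)=(w_{H,ij}(t;z))_{i,j=1}^2$ is the fundamental solution, i.e. the solution of $\frac{\partial}{\partial t}W_H(t;z)J=zW_H(t;z)H(t)$, $W_H(a;z)=I$, with $J=\begin{pmatrix}0&-1\\1&0\end{pmatrix}$. $f\asymp g$ means $c_1g\le f\le c_2g$ for some constants $c_1,c_2>0$. *)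

(* Defs.v *)
From HB Require Import structures.
From mathcomp Require Import all_boot all_order all_algebra.
From mathcomp Require Import all_classical all_reals all_analysis.
Set Implicit Arguments. Unset Strict Implicit. Unset Printing Implicit Defensive.
Import Order.TTheory GRing.Theory Num.Theory.
Import numFieldNormedType.Exports.
Local Open Scope classical_set_scope.
Local Open Scope ring_scope.

Section Defs.
Variable R : realType.

Definition leb : {measure set (measurableTypeR R) -> \bar R} :=
  @lebesgue_measure R.

Definition Iab (a : R) (b : \bar R) : set R :=
  [set t | a < t /\ (t%:E < b)%E].

Definition Ia_b (a : R) (b : \bar R) : set R :=
  [set t | a <= t /\ (t%:E < b)%E].

Definition Hmat (h1 h2 h3 : R -> R) (t : R) : 'M[R]_2 :=
  \matrix_(i < 2, j < 2)
    if i == j then (if i == ord0 then h1 t else h2 t) else h3 t.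

Definition Jmat : 'M[R]_2 :=
  \matrix_(i < 2, j < 2) if i == j then 0 else (if i == ord0 then -1 else 1).

Definition psd (M : 'M[R]_2) : Prop :=
  forall v : 'cV[R]_2, 0 <= (v^T *m M *m v) ord0 ord0.

Definition xi (phi : R) : 'cV[R]_2 :=
  \col_(i < 2) (if i == ord0 then cos phi else sin phi).

Definition Hamiltonian (a : R) (b : \bar R) (h1 h2 h3 : R -> R) : Prop :=
  [/\ (a%:E < b)%E,
      measurable_fun (Iab a b) h1 /\ measurable_fun (Iab a b) h2 /\
        measurable_fun (Iab a b) h3,
      (forall c : R, a < c -> (c%:E < b)%E ->
         [/\ leb.-integrable `]a, c[ (fun t => (h1 t)%:E),
             leb.-integrable `]a, c[ (fun t => (h2 t)%:E) &
             leb.-integrable `]a, c[ (fun t => (h3 t)%:E)]),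
      {ae leb, forall t, Iab a b t -> psd (Hmat h1 h2 h3 t)} &
      leb [set t | Iab a b t /\ Hmat h1 h2 h3 t = 0] = 0%E].

Definition definite (a : R) (b : \bar R) (h1 h2 h3 : R -> R) : Prop :=
  ~ (exists phi : R,
       {ae leb, forall t, Iab a b t ->
          Hmat h1 h2 h3 t = (h1 t + h2 t) *: (xi phi *m (xi phi)^T)}).

Definition limit_circle (a : R) (b : \bar R) (h1 h2 h3 : R -> R) : Prop :=
  (\int[leb]_(t in Iab a b) ((h1 t + h2 t)%:E) < +oo)%E.

Definition omega (h : R -> R) (s t : R) : R := Rintegral leb `[s, t] h.

Definition detOmega (h1 h2 h3 : R -> R) (s t : R) : R :=
  omega h1 s t * omega h2 s t - (omega h3 s t) ^+ 2.

Definition compatible_pair (a : R) (b : \bar R) (h1 h2 h3 : R -> R)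
  (r0 cm cp : R) (that : R -> R) (shat : R -> R -> R) : Prop :=
  (forall r, r0 < r ->
     Iab a b (that r) /\
     cm / r ^+ 2 <= detOmega h1 h2 h3 a (that r) <= cp / r ^+ 2) /\
  (forall r t, r0 < r -> Iab a b t -> that r <= t ->
     [/\ a <= shat t r, ((shat t r)%:E < b)%E, shat t r <= t &
         cm / r ^+ 2 <= detOmega h1 h2 h3 (shat t r) t <= cp / r ^+ 2]).

Definition kernelK (a : R) (b : \bar R) (h1 h2 h3 : R -> R) (cp : R)
  (that : R -> R) (shat : R -> R -> R) (t r : R) : R :=
  (if (a <= t) && (t < that r) then
     omega h2 a t * h1 t / (cp / r ^+ 2 + (omega h3 a t) ^+ 2)
   else 0) +
  (if (that r <= t) && (t%:E < b)%E then
     h1 t / omega h1 (shat t r) t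
   else 0).

(* W_H(t; i r) = U r t + i V r t is the fundamental solution:
   d/dt W J = z W H, W(a) = I, i.e. W(t) = I - z int_a^t W H J (J^-1 = -J);
   with z = i r this reads U(t) = I + r int_a^t V H J,
   V(t) = - r int_a^t U H J. *)
Definition fundamental_solution (a : R) (b : \bar R) (h1 h2 h3 : R -> R)
  (r : R) (U V : R -> 'M[R]_2) : Prop :=
  forall t, a <= t -> (t%:E < b)%E -> forall i j : 'I_2,
    [/\ leb.-integrable `[a, t]
          (fun s => ((V s *m Hmat h1 h2 h3 s *m Jmat) i j)%:E),
        leb.-integrable `[a, t]
          (fun s => ((U s *m Hmat h1 h2 h3 s *m Jmat) i j)%:E),
        U t i j = (1%:M : 'M[R]_2) i j
                  + r * Rintegral leb `[a, t]
                          (fun s => (V s *m Hmat h1 h2 h3 s *m Jmat) i j) &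
        V t i j = - (r * Rintegral leb `[a, t]
                          (fun s => (U s *m Hmat h1 h2 h3 s *m Jmat) i j))].

Definition toward_b (b : \bar R) : set_system R :=
  match b with
  | EFin c => at_left c
  | _ => pinfty_nbhs R
  end.

Definition cmod (u v : R) : R := Num.sqrt (u ^+ 2 + v ^+ 2).

End Defs.

(* Main.v *)
(** For [z = i r] let [(w1, w2)] be the second row of the fundamental solution, so that
    [w2 = w_22], and put [Q = - Im (w1 conj(w2))], [N = |w2|^2]. Then [Q' = r w H w^*] and
    [N' = 2 r h1 Q], hence [ln |w2(x)|] is the integral of [r h1 Q / N] over [[a, x]], and it
    suffices to compare [r Q / N] with the kernel pointwise. By the Cauchy-Schwarz inequality
    for the form [H], the increments of [w] over a subinterval of [[s, t]] are controlled by
    [Omega(s, t)] and the energy [E], the integral of [w H w^*] over [[s, t]], with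
    [r E <= Q(t)]. Integrating over [[s, t]] gives
    [w(t) Omega(s, t) w(t)^* <= (2 + 4 r^2 det Omega(s, t)) E], from which both bounds follow
    by algebra: with [s = shat(t; r)] for [t >= that(r)], and with [s = a], where in addition
    [|w1(t)|^2 <= r omega_2(a, t) Q(t)], for [t < that(r)]. *)
Require Import Defs.
From HB Require Import structures.
From mathcomp Require Import all_boot all_order all_algebra.
From mathcomp Require Import all_classical all_reals all_analysis.
From mathcomp Require Import measurable_realfun ring lra.
Import Order.TTheory GRing.Theory Num.Theory.
Import numFieldNormedType.Exports.
Local Open Scope classical_set_scope.
Local Open Scope ring_scope.

(** * Calculus of absolutely continuous functions in integral form *)

Section Integrals.
Set Implicit Arguments.
Unset Strict Implicit.
Variable R : realType.
Local Notation mu := (leb R).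
Local Notation int s t f := (Rintegral mu `[s, t] f).
Implicit Types (a s t T x : R) (f g m F G : R -> R).

(** The entries of [H] are only integrable, so the solution is absolutely continuous and need not be
    differentiable everywhere. Derivatives are therefore encoded by integral identities,
    [primitive], and the product and logarithm rules are proved for increments. The two conditions
    on determinants play opposite roles: [det Omega <= cp / r^2] turns the factor
    [2 + 4 r^2 det Omega] into the constant [M = 2 + 4 cp], while [det Omega >= cm / r^2] keeps
    [w Omega w^*] from degenerating. For [t < that r] the latter is lost, since [det Omega(a, t)]
    tends to [0] at [a]; the bound on [w1], which rests on [w1(a) = 0], replaces it. Two obstacles
    are measure-theoretic: [H] is nonnegative only almost everywhere, and the kernel may fail to be
    measurable. *)

Definition integrable_on s t f := mu.-integrable `[s, t] (EFin \o f).
Local Notation intg := integrable_on.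

Lemma integrable_on_sub s t s' t' f : s <= s' -> t' <= t ->
  intg s t f -> intg s' t' f.
Proof.
move=> ss tt; apply: integrableS; [exact: measurable_itv|exact: measurable_itv|].
by apply: subset_itv; rewrite bnd_simp.
Qed.

Lemma eq_integrable_on s t f g : {in `[s, t], f =1 g} -> intg s t f -> intg s t g.
Proof.
move=> fg; apply: eq_integrable; first exact: measurable_itv.
by move=> x /set_mem xs; rewrite /= fg.
Qed.

Lemma integrable_onD s t f g : intg s t f -> intg s t g ->
  intg s t (fun x => f x + g x).
Proof.
move=> If Ig; have mI : measurable (`[s, t]%classic : set (measurableTypeR R)) by exact: measurable_itv.
by apply: (eq_integrable mI _ _ _ (integrableD mI If Ig)).
Qed.

Lemma integrable_onZ s t k f : intg s t f -> intg s t (fun x => k * f x).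
Proof.
move=> If; have mI : measurable (`[s, t]%classic : set (measurableTypeR R)) by exact: measurable_itv.
by apply: (eq_integrable mI _ _ _ (integrableZl mI k If)).
Qed.

Lemma integrable_onN s t f : intg s t f -> intg s t (fun x => - f x).
Proof.
by move=> If; apply: eq_integrable_on (integrable_onZ (-1) If) => x _; rewrite mulN1r.
Qed.

Lemma integrable_onB s t f g : intg s t f -> intg s t g ->
  intg s t (fun x => f x - g x).
Proof. by move=> If Ig; apply: integrable_onD => //; exact: integrable_onN. Qed.

Lemma integrable_on_norm s t f : intg s t f -> intg s t (fun x => `|f x|).
Proof. by move=> If; exact: integrable_norm If. Qed.

Lemma int_set1 s f : int s s f = 0.
Proof. by rewrite set_itv1 Rintegral_set1. Qed.

Lemma int_split s t x f : s <= t -> t <= x -> intg s x f ->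
  int s x f = int s t f + int t x f.
Proof.
move=> st tx If.
have -> : int t x f = Rintegral mu `]t, x] f.
  rewrite -Rintegral_itv_obnd_cbnd//.
  apply: integrableS If; [exact: measurable_itv|exact: measurable_itv|].
  by apply: subset_itv; rewrite bnd_simp.
by rewrite -(@Rintegral_itvB _ f _ _ t If) ?bnd_simp// addrC subrK.
Qed.

Lemma int_D s t f g : intg s t f -> intg s t g ->
  int s t (fun x => f x + g x) = int s t f + int s t g.
Proof. by move=> If Ig; rewrite RintegralD. Qed.

Lemma int_B s t f g : intg s t f -> intg s t g ->
  int s t (fun x => f x - g x) = int s t f - int s t g.
Proof. by move=> If Ig; rewrite RintegralB. Qed.

Lemma int_Z s t k f : intg s t f -> int s t (fun x => k * f x) = k * int s t f.
Proof. by move=> If; rewrite RintegralZl. Qed.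

Lemma eq_int s t f g : {in `[s, t], f =1 g} -> int s t f = int s t g.
Proof. by move=> fg; apply: eq_Rintegral => x /set_mem xs; rewrite fg. Qed.

Lemma le_int s t f g : intg s t f -> intg s t g ->
  {in `[s, t], forall x, f x <= g x} -> int s t f <= int s t g.
Proof.
by move=> If Ig fg; apply: le_Rintegral => // x xs; rewrite fg.
Qed.

Lemma int_ge0 s t f : {in `[s, t], forall x, 0 <= f x} -> 0 <= int s t f.
Proof. by move=> f0; apply: Rintegral_ge0 => x xs; rewrite f0. Qed.

Lemma norm_int_le s t f : intg s t f -> `|int s t f| <= int s t (fun x => `|f x|).
Proof. by move=> If; exact: le_normr_Rintegral. Qed.

Lemma int_sub_le s t s' t' f : {in `[s, t], forall x, 0 <= f x} -> intg s t f ->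
  s <= s' -> s' <= t' -> t' <= t -> int s' t' f <= int s t f.
Proof.
move=> f0 If ss st tt.
have I1 := integrable_on_sub ss (lexx t) If.
rewrite (int_split ss _ If) ?(le_trans st)// (int_split st _ I1)//.
have : 0 <= int s s' f.
  apply: int_ge0 => x xs; apply: f0; apply: subset_itvl xs.
  by rewrite bnd_simp (le_trans st).
have : 0 <= int t' t f.
  apply: int_ge0 => x xs; apply: f0; apply: subset_itvr xs.
  by rewrite bnd_simp (le_trans ss).
by move=> A B; rewrite addrA addrAC lerDr addr_ge0.
Qed.

(** Supremum argument: the set of [t] with [P a t] contains its supremum and cannot stop before [T].
    It serves to add up local error estimates without an explicit subdivision. *)
Lemma additive_local_global (P : R -> R -> Prop) a T : a <= T ->
  (forall s t x, a <= s -> s <= t -> t <= x -> x <= T -> P s t -> P t x -> P s x) ->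
  (forall c, a <= c -> c <= T -> exists2 d, 0 < d &
     forall s t, a <= s -> s <= t -> t <= T -> c - d < s -> t < c + d -> P s t) ->
  P a T.
Proof.
move=> aT add loc.
pose S := [set t | a <= t /\ t <= T /\ P a t].
have Sa : S a.
  split=> //; split=> //; have [d d0 H] := loc a (lexx a) aT.
  by apply: H => //; rewrite ?ltrBlDr ltrDl.
have hS : has_sup S by split; [exists a|exists T => x [_ []]].
have ac : a <= sup S by apply: ub_le_sup => //; case: hS.
have cT : sup S <= T by apply: ge_sup; [exists a|move=> x [_ []]].
have [d d0 H] := loc _ ac cT.
have [t [[at_ [tT Pt]] ct]] : exists t, S t /\ sup S - d < t.
  by have [t St] := sup_adherent d0 hS; exists t.
have tc : t <= sup S by apply: ub_le_sup; [case: hS|split].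
have key x : sup S <= x -> x <= T -> x < sup S + d -> P a x.
  move=> cx xT xd; apply: (add a t x) => //; first exact: le_trans cx.
  by apply: H => //; exact: le_trans cx.
have [TS|ST] := leP T (sup S); first by apply: key => //; rewrite (le_lt_trans TS)// ltrDl.
(* A point strictly beyond [sup S], yet inside the neighbourhood where [P] holds locally. *)
pose x := Num.min T (sup S + d / 2).
have d20 : 0 < d / 2 by rewrite divr_gt0.
have cx : sup S < x by rewrite /x lt_min ST ltrDl d20.
have xT : x <= T by rewrite /x ge_min lexx.
have : x <= sup S.
  apply: ub_le_sup; first by case: hS.
  split; first exact: le_trans (ltW cx).
  split=> //; apply: key => //; first exact: ltW.
  by rewrite (@le_lt_trans _ _ (sup S + d / 2))// ?ge_min ?lexx ?orbT// ltrD2l; lra.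
by rewrite leNgt cx.
Qed.

Definition continuous_on a T F := {within `[a, T], continuous F}.

Lemma continuous_on_ball a T F c e : continuous_on a T F ->
  c \in `[a, T] -> 0 < e ->
  exists2 d, 0 < d & {in `[a, T], forall s, `|s - c| < d -> `|F s - F c| < e}.
Proof.
move=> cF cI e0.
have /subspace_continuousP/(_ c cI)/cvgrPdist_lt/(_ e e0) := cF.
rewrite /within/= => -[d d0 H].
exists d => // s sI sc; rewrite distrC; apply: H => //=.
by rewrite /ball /= distrC.
Qed.

Lemma integrable_onMl a T F f : continuous_on a T F -> intg a T f ->
  intg a T (fun x => F x * f x).
Proof.
move=> cF If.
have mI : measurable (`[a, T]%classic : set (measurableTypeR R)) by exact: measurable_itv.
have bF : [bounded F x | x in `[a, T]].
  have cI : compact (F @` `[a, T]).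
    exact: (continuous_compact cF (@segment_compact _ a T)).
  have [M [Mr HM]] := compact_bounded cI.
  by exists M; split=> // y My x xI; apply: HM My _ _; exists x.
have mF : measurable_fun `[a, T] F by exact: subspace_continuous_measurable_fun.
exact: (@integrableMr _ _ _ mu _ mI F (EFin \o f) mF bF If).
Qed.

(** [F] is absolutely continuous on [[a, T]] with derivative [f] almost everywhere, expressed
    without differentiation. *)
Definition primitive a T F f := intg a T f /\
  forall t, a <= t -> t <= T -> F t = F a + int a t f.

Lemma primitive_incr a T F f s t : primitive a T F f ->
  a <= s -> s <= t -> t <= T -> F t - F s = int s t f.
Proof.
move=> [If HF] as_ st tT.
rewrite (HF t) ?(le_trans as_)// (HF s) ?(le_trans st)//.
rewrite (@int_split a s t) //; last exact: integrable_on_sub If.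
by rewrite opprD addrACA subrr add0r addrAC subrr add0r.
Qed.

Lemma primitive_continuous a T F f : a <= T -> primitive a T F f ->
  continuous_on a T F.
Proof.
move=> aT [If HF].
have := @parameterized_integral_continuous _ a T f aT If.
move=> H; apply: (@subspace_eq_continuous _ _ _ (fun x => F a + int a x f)).
  by move=> x /set_mem; rewrite /= in_itv/= => /andP[ax xT]; exact/esym/HF.
by move=> x; apply: cvgD; [exact: cvg_cst|exact: H].
Qed.

(** Errors over small intervals are at most [e] times the integral of a fixed majorant [m]. Such
    bounds add under concatenation, so the total error is at most [e] times a constant, for every
    [e]. *)
Lemma primitive_local a T F f m : a <= T -> intg a T f -> intg a T m ->
  (forall e c, 0 < e -> c \in `[a, T] -> exists2 d, 0 < d &
    forall s t, a <= s -> s <= t -> t <= T -> c - d < s -> t < c + d ->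
      `|F t - F s - int s t f| <= e * int s t m) ->
  primitive a T F f.
Proof.
move=> aT If Im H; split=> // x ax xT.
suff : F x - F a - int a x f = 0 by move=> K; rewrite -[LHS]subr0 -K; ring.
apply/normr0_eq0/eqP; rewrite eq_le normr_ge0 andbT.
set M := int a x m.
have key e : 0 < e -> `|F x - F a - int a x f| <= e * M.
  move=> e0.
  apply: (@additive_local_global
    (fun s t => `|F t - F s - int s t f| <= e * int s t m) a x ax).
    move=> s t y as_ st ty yx P1 P2.
    rewrite (@int_split s t y f) ?(@int_split s t y m)//; first last.
    - by apply: integrable_on_sub If => //; exact: le_trans xT.
    - by apply: integrable_on_sub Im => //; exact: le_trans xT.
    rewrite mulrDr (le_trans _ (lerD P1 P2))// (le_trans _ (ler_normD _ _))//.
    by rewrite le_eqVlt; apply/orP; left; apply/eqP; congr Num.norm; ring.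
  move=> c ac cx; have [|d d0 Hd] := H e c e0; first by rewrite in_itv/= ac (le_trans cx).
  by exists d => // s t *; apply: Hd => //; exact: le_trans xT.
apply/ler_addgt0Pr => e e0; rewrite add0r.
have M1 : 0 < `|M| + 1 by rewrite ltr_wpDl.
have := key (e / (`|M| + 1)); rewrite divr_gt0// => /(_ isT) /le_trans; apply.
rewrite mulrAC ler_pdivrMr// ler_pM2l// (le_trans (ler_norm _))//.
by rewrite lerDl.
Qed.

Lemma primitiveD a T F G f g : primitive a T F f -> primitive a T G g ->
  primitive a T (fun x => F x + G x) (fun x => f x + g x).
Proof.
move=> [If HF] [Ig HG]; split; first exact: integrable_onD.
move=> t at_ tT; rewrite HF// HG// int_D; first ring; exact: (integrable_on_sub _ tT).
Qed.

Lemma primitiveZ a T F f k : primitive a T F f ->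
  primitive a T (fun x => k * F x) (fun x => k * f x).
Proof.
move=> [If HF]; split; first exact: integrable_onZ.
move=> t at_ tT; rewrite HF// int_Z; first ring; exact: (integrable_on_sub _ tT).
Qed.

Lemma eq_primitive a T F f F' f' : {in `[a, T], F =1 F'} -> {in `[a, T], f =1 f'} ->
  primitive a T F f -> primitive a T F' f'.
Proof.
move=> FF ff [If HF]; split; first exact: eq_integrable_on If.
move=> t at_ tT; rewrite -!FF ?in_itv/= ?lexx ?at_ ?(le_trans at_)// HF//.
congr (_ + _); apply: eq_int => x; rewrite in_itv/= => /andP[ax xt].
by rewrite ff// in_itv/= ax (le_trans xt).
Qed.

(** Near a point both factors are almost constant, and their small oscillation multiplies
    [|f| + |g|]. *)
Lemma primitiveM a T F G f g : a <= T -> primitive a T F f -> primitive a T G g ->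
  primitive a T (fun x => F x * G x) (fun x => G x * f x + F x * g x).
Proof.
move=> aT pF pG; have [If _] := pF; have [Ig _] := pG.
have cF := primitive_continuous aT pF.
have cG := primitive_continuous aT pG.
have I1 := integrable_onMl cG If.
have I2 := integrable_onMl cF Ig.
apply: (primitive_local (m := fun x => `|f x| + `|g x|) aT).
- exact: integrable_onD.
- by apply: integrable_onD; exact: integrable_on_norm.
move=> e c e0 cI.
have e20 : 0 < e / 2 by rewrite divr_gt0.
have [d1 d10 H1] := continuous_on_ball cF cI e20.
have [d2 d20 H2] := continuous_on_ball cG cI e20.
have [d [d0 dd1 dd2]] : exists d, [/\ 0 < d, d <= d1 & d <= d2].
  by exists (Num.min d1 d2); rewrite lt_min d10 d20 !ge_min !lexx orbT.
exists d => // s t as_ st tT cs tc.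
have aux u : s <= u -> u <= t -> `|F u - F c| < e / 2 /\ `|G u - G c| < e / 2.
  move=> su ut.
  have uI : u \in `[a, T] by rewrite in_itv/= (le_trans as_)// (le_trans ut).
  by split; [apply: H1 => //|apply: H2 => //]; rewrite ltr_norml; apply/andP; split; lra.
have sub h : intg a T h -> intg s t h by exact: integrable_on_sub.
have J1 := sub _ I1; have J2 := sub _ I2; have Jf := sub _ If; have Jg := sub _ Ig.
(* From [F t G t - F s G s = G t (F t - F s) + F s (G t - G s)], each increment being written as an
   integral. *)
have -> : F t * G t - F s * G s - int s t (fun x => G x * f x + F x * g x) =
   int s t (fun u => (G t * f u - G u * f u) + (F s * g u - F u * g u)).
  rewrite int_D// int_D//; [|by apply: integrable_onB => //; exact: integrable_onZ..].
  rewrite !int_B//; [|exact: integrable_onZ..].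
  rewrite !int_Z// -(primitive_incr pF as_ st tT).
  rewrite -(primitive_incr pG as_ st tT); ring.
have J3 : intg s t (fun u => (G t * f u - G u * f u) + (F s * g u - F u * g u)).
  by apply: integrable_onD; apply: integrable_onB => //; exact: integrable_onZ.
have J4 : intg s t (fun x => `|f x| + `|g x|).
  by apply: integrable_onD; exact: integrable_on_norm.
rewrite (le_trans (norm_int_le J3))// -int_Z//.
apply: le_int; [exact: integrable_on_norm|exact: integrable_onZ|].
move=> u; rewrite in_itv/= => /andP[su ut].
rewrite -!mulrBl (le_trans (ler_normD _ _))// !normrM mulrDr lerD// ler_wpM2r//.
  have [_] := aux t st (lexx t); have [_] := aux u su ut.
  rewrite !ltr_norml => /andP[? ?] /andP[? ?]; rewrite ler_norml; apply/andP; split; lra.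
have [+ _] := aux s (lexx s) st; have [+ _] := aux u su ut.
rewrite !ltr_norml => /andP[? ?] /andP[? ?]; rewrite ler_norml; apply/andP; split; lra.
Qed.

(** The tangent bound [ln p - ln q <= (p - q) / q], used in both directions, puts the remainder
    between [- (z - y)^2 / (y z)] and [0]. In the application one factor [|z - y|] is small and the
    other is at most the integral of [|f|]. *)
Lemma ln_taylor1 (y z : R) : 1 <= y -> 1 <= z ->
  `|ln z - ln y - (z - y) / y| <= `|z - y| ^+ 2.
Proof.
move=> y1 z1; have y0 : 0 < y by exact: lt_le_trans y1.
have z0 : 0 < z by exact: lt_le_trans z1.
have ub (p q : R) : 0 < p -> 0 < q -> ln p - ln q <= (p - q) / q.
  move=> p0 q0; rewrite -ln_div ?posrE//.
  have -> : (p - q) / q = p / q - 1 by field; rewrite gt_eqF.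
  have pq : 0 < p / q by rewrite divr_gt0.
  have := @le_ln1Dx R (p / q - 1); rewrite (addrC 1) subrK; apply.
  by rewrite ltrBrDl subrr.
have A := ub _ _ z0 y0; have B := ub _ _ y0 z0.
have C : (z - y) / y - (z - y) / z = (z - y) ^+ 2 / (y * z) by field; rewrite !gt_eqF.
have D : (z - y) ^+ 2 / (y * z) <= (z - y) ^+ 2.
  rewrite ler_pdivrMr ?mulr_gt0// ler_peMr ?sqr_ge0//.
  by rewrite -[leLHS]mulr1 ler_pM.
have E : (y - z) / z = - ((z - y) / z) by rewrite -opprB mulNr.
have F := sqr_ge0 (z - y).
rewrite real_normK ?num_real// ler_norml; apply/andP; split; lra.
Qed.

Lemma primitive_ln a T F f : a <= T -> primitive a T F f ->
  {in `[a, T], forall x, 1 <= F x} ->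
  primitive a T (fun x => ln (F x)) (fun x => f x / F x).
Proof.
move=> aT pF F1; have [If _] := pF.
have cF := primitive_continuous aT pF.
have ciF : continuous_on a T (fun x => (F x)^-1).
  apply/subspace_continuousP => x xI.
  apply: (@cvgV _ _ _ _ F); last by move/subspace_continuousP: cF; apply.
  by rewrite gt_eqF// (lt_le_trans ltr01)// F1.
have I1 : intg a T (fun x => f x / F x).
  by apply: eq_integrable_on (integrable_onMl ciF If) => x _; rewrite mulrC.
apply: (primitive_local (m := fun x => `|f x|) aT I1).
  exact: integrable_on_norm.
move=> e c e0 cI.
(* Distance [e / 4] from [F c] makes the oscillation of [F] at most [e / 2]; the errors [A] and [B]
   below then contribute [e / 2] each. *)
have e20 : 0 < e / 4 by rewrite divr_gt0.
have [d d0 H] := continuous_on_ball cF cI e20.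
exists d => // s t as_ st tT cs tc.
have inI u : s <= u -> u <= t -> u \in `[a, T].
  by move=> su ut; rewrite in_itv/= (le_trans as_)// (le_trans ut).
have aux u : s <= u -> u <= t -> `|F u - F s| <= e / 2.
  move=> su ut.
  have := H u (inI u su ut); have := H s (inI s (lexx s) st).
  have -> : `|u - c| < d by rewrite ltr_norml; apply/andP; split; lra.
  have -> : `|s - c| < d by rewrite ltr_norml; apply/andP; split; lra.
  move=> /(_ isT) + /(_ isT).
  rewrite !ltr_norml => /andP[? ?] /andP[? ?]; rewrite ler_norml; apply/andP; split; lra.
have Fs : 1 <= F s by exact: F1 (inI s (lexx s) st).
have Ft : 1 <= F t by exact: F1 (inI t st (lexx t)).
have sub h : intg a T h -> intg s t h by exact: integrable_on_sub.
have Jf := sub _ If; have J1 := sub _ I1.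
have incr := primitive_incr pF as_ st tT.
have Jn : intg s t (fun x => `|f x|) by exact: integrable_on_norm.
have Fts : `|F t - F s| <= int s t (fun x => `|f x|).
  by rewrite incr; exact: norm_int_le.
have M0 : 0 <= int s t (fun x => `|f x|) by apply: int_ge0 => x _.
have A : `|ln (F t) - ln (F s) - (F t - F s) / F s| <=
         e / 2 * int s t (fun x => `|f x|).
  by rewrite (le_trans (ln_taylor1 Fs Ft))// expr2 ler_pM// aux.
have B : `|(F t - F s) / F s - int s t (fun x => f x / F x)| <=
         e / 2 * int s t (fun x => `|f x|).
  have -> : (F t - F s) / F s = int s t (fun x => (F s)^-1 * f x).
    by rewrite incr int_Z// mulrC.
  rewrite -int_B//; last exact: integrable_onZ.
  have J : intg s t (fun x => (F s)^-1 * f x - f x / F x).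
    by apply: integrable_onB => //; exact: integrable_onZ.
  rewrite (le_trans (norm_int_le J))// -int_Z//.
  apply: le_int; [exact: integrable_on_norm|exact: integrable_onZ|].
  move=> u; rewrite in_itv/= => /andP[su ut].
  have Fu : 1 <= F u by exact: F1 (inI u su ut).
  have F0 : 0 < F u by exact: lt_le_trans Fu.
  have Fs0 : 0 < F s by exact: lt_le_trans Fs.
  have -> : (F s)^-1 * f u - f u / F u = (F u - F s) / (F s * F u) * f u.
    by field; rewrite !gt_eqF.
  rewrite normrM ler_wpM2r// normrM (le_trans _ (aux u su ut))//.
  rewrite ler_piMr// gtr0_norm ?invr_gt0 ?mulr_gt0// invf_le1 ?mulr_gt0//.
  by rewrite -[leLHS]mulr1 ler_pM.
have -> : ln (F t) - ln (F s) - int s t (fun x => f x / F x) =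
  (ln (F t) - ln (F s) - (F t - F s) / F s) +
  ((F t - F s) / F s - int s t (fun x => f x / F x)) by ring.
rewrite (le_trans (ler_normD _ _))// (le_trans (lerD A B))//.
by rewrite le_eqVlt; apply/orP; left; apply/eqP; field.
Qed.

End Integrals.

(** * Positive semidefinite binary quadratic forms *)

Section QuadraticForms.
Set Implicit Arguments.
Unset Strict Implicit.
Variable R : realType.
Implicit Types (A B C x y l : R).

Lemma sqr_le0 x : x ^+ 2 <= 0 -> x = 0.
Proof. by move=> H; apply/eqP; rewrite -sqrf_eq0 eq_le H sqr_ge0. Qed.

Lemma discriminant_le A B C : 0 <= C ->
  (forall l, 0 <= A + 2 * l * B + l ^+ 2 * C) -> B ^+ 2 <= A * C.
Proof.
rewrite le_eqVlt => /predU1P[<-|C0] H.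
  have [->|B0] := eqVneq B 0; first by rewrite mulr0 expr0n.
  (* With [C = 0] the expression is affine in [l], and this [l] gives it the value [-1]. *)
  have := H (- (A + 1) / (2 * B)).
  have -> : A + 2 * (- (A + 1) / (2 * B)) * B + (- (A + 1) / (2 * B)) ^+ 2 * 0 = -1.
    by field.
  by rewrite lerNr oppr0 ler10.
have := H (- B / C).
have -> : A + 2 * (- B / C) * B + (- B / C) ^+ 2 * C = (A * C - B ^+ 2) / C.
  by field; rewrite gt_eqF.
by rewrite pmulr_lge0 ?invr_gt0// subr_ge0.
Qed.

(** Semidefiniteness, through its minors, of the matrix with diagonal [p1], [p2] and off-diagonal
    entry [p3]. *)
Definition psd_coef (p1 p2 p3 : R) := [/\ 0 <= p1, 0 <= p2 & p3 ^+ 2 <= p1 * p2].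

Definition qform (p1 p2 p3 x y : R) := p1 * x ^+ 2 + 2 * p3 * (x * y) + p2 * y ^+ 2.

Lemma qform_ge0 p1 p2 p3 x y : psd_coef p1 p2 p3 -> 0 <= qform p1 p2 p3 x y.
Proof.
move=> [p10 p20 p3l]; rewrite /qform.
move: p10; rewrite le_eqVlt => /predU1P[p10|p10].
  have : p3 ^+ 2 <= 0 by rewrite (le_trans p3l)// -p10 mul0r.
  move=> /sqr_le0 ->; rewrite -p10 !(mul0r, mulr0) !add0r.
  by rewrite mulr_ge0// sqr_ge0.
rewrite -(pmulr_rge0 _ p10).
have -> : p1 * (p1 * x ^+ 2 + 2 * p3 * (x * y) + p2 * y ^+ 2) =
  (p1 * x + p3 * y) ^+ 2 + (p1 * p2 - p3 ^+ 2) * y ^+ 2 by ring.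
by rewrite addr_ge0 ?sqr_ge0// mulr_ge0 ?sqr_ge0// subr_ge0.
Qed.

Lemma psd_coefP p1 p2 p3 :
  (forall x y, 0 <= qform p1 p2 p3 x y) -> psd_coef p1 p2 p3.
Proof.
move=> H.
have p10 : 0 <= p1 by have := H 1 0; rewrite /qform !(expr1n, expr0n, mulr0, mulr1, addr0).
have p20 : 0 <= p2 by have := H 0 1; rewrite /qform !(expr1n, expr0n, mulr0, mul0r, mulr1, add0r).
split=> //; rewrite [leRHS]mulrC; apply: (discriminant_le _ _) => // l.
have := H l 1; congr (0 <= _); rewrite /qform; ring.
Qed.

(* The trace of [p] against the adjugate of [q]. *)
Lemma qform_adj_ge0 p1 p2 p3 q1 q2 q3 : psd_coef p1 p2 p3 -> psd_coef q1 q2 q3 ->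
  0 <= q1 * p2 + q2 * p1 - 2 * q3 * p3.
Proof.
move=> [p10 p20 p3l] Q; have [q10 q20 q3l] := Q.
move: p10; rewrite le_eqVlt => /predU1P[p10|p10].
  have : p3 ^+ 2 <= 0 by rewrite (le_trans p3l)// -p10 mul0r.
  move=> /sqr_le0 ->; rewrite -p10 !mulr0 addr0 subr0.
  by rewrite mulr_ge0.
rewrite -(pmulr_rge0 _ p10).
have -> : p1 * (q1 * p2 + q2 * p1 - 2 * q3 * p3) =
  qform q1 q2 q3 p3 (- p1) + q1 * (p1 * p2 - p3 ^+ 2) by rewrite /qform; ring.
by rewrite addr_ge0 ?qform_ge0// mulr_ge0// subr_ge0.
Qed.

(** The determinant of a sum is the sum of the determinants plus the mixed term of
    [qform_adj_ge0]. *)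
Lemma det_le_addr p1 p2 p3 q1 q2 q3 : psd_coef p1 p2 p3 -> psd_coef q1 q2 q3 ->
  p1 * p2 - p3 ^+ 2 <= (p1 + q1) * (p2 + q2) - (p3 + q3) ^+ 2.
Proof.
move=> Pp Pq; have := qform_adj_ge0 Pp Pq; have [_ _ ?] := Pq.
have -> : (p1 + q1) * (p2 + q2) - (p3 + q3) ^+ 2 =
  (p1 * p2 - p3 ^+ 2) + (q1 * p2 + q2 * p1 - 2 * q3 * p3) +
  (q1 * q2 - q3 ^+ 2) by ring.
move=> ?; lra.
Qed.

End QuadraticForms.

(** * The matrix [Omega] and the Cauchy-Schwarz inequality for [H] *)

Section HamiltonianIntegrals.
Set Implicit Arguments.
Unset Strict Implicit.
Variable R : realType.
Local Notation mu := (leb R).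
Local Notation int s t f := (Rintegral mu `[s, t] f).
Local Notation intg := (@integrable_on R).
Variables (a T : R) (h1 h2 h3 : R -> R).
Hypotheses (Ih1 : intg a T h1) (Ih2 : intg a T h2) (Ih3 : intg a T h3).
Hypothesis hpsd : forall x, x \in `[a, T] -> psd_coef (h1 x) (h2 x) (h3 x).

Lemma integrable_on_lin x y : continuous_on a T x -> continuous_on a T y ->
  intg a T (fun s => x s * h1 s + y s * h3 s) /\
  intg a T (fun s => x s * h3 s + y s * h2 s).
Proof. by move=> cx cy; split; apply: integrable_onD; exact: integrable_onMl. Qed.

Lemma integrable_on_qform x y : continuous_on a T x -> continuous_on a T y ->
  intg a T (fun s => qform (h1 s) (h2 s) (h3 s) (x s) (y s)).
Proof.
move=> cx cy; have [I1 I2] := integrable_on_lin cx cy.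
apply: eq_integrable_on (integrable_onD (integrable_onMl cx I1) (integrable_onMl cy I2)).
by move=> s _; rewrite /qform; ring.
Qed.

Lemma omega_qform s t x y : a <= s -> t <= T ->
  int s t (fun z => qform (h1 z) (h2 z) (h3 z) x y) =
  qform (omega h1 s t) (omega h2 s t) (omega h3 s t) x y.
Proof.
move=> as_ tT.
have sub f : intg a T f -> intg s t f by exact: integrable_on_sub.
have J1 := sub _ Ih1; have J2 := sub _ Ih2; have J3 := sub _ Ih3.
rewrite (@eq_int _ _ _ _ (fun z => (x ^+ 2 * h1 z + (2 * (x * y)) * h3 z) + y ^+ 2 * h2 z)).
  rewrite int_D ?int_D ?int_Z//; try by repeat apply: integrable_onD; exact: integrable_onZ.
  by rewrite /qform /omega; ring.
by move=> z _; rewrite /qform; ring.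
Qed.

Lemma omega_psd s t : a <= s -> t <= T ->
  psd_coef (omega h1 s t) (omega h2 s t) (omega h3 s t).
Proof.
move=> as_ tT; apply: psd_coefP => x y; rewrite -omega_qform//.
apply: int_ge0 => z; rewrite in_itv/= => /andP[sz zt].
by apply/qform_ge0/hpsd; rewrite in_itv/= (le_trans as_)// (le_trans zt).
Qed.

Lemma omega_split s t z : a <= s -> s <= t -> t <= z -> z <= T ->
  [/\ omega h1 s z = omega h1 s t + omega h1 t z,
      omega h2 s z = omega h2 s t + omega h2 t z &
      omega h3 s z = omega h3 s t + omega h3 t z].
Proof.
by move=> as_ st tz zT; split; rewrite /omega -int_split//;
   exact: (integrable_on_sub as_ zT).
Qed.

(** Makes the upper bound on the determinant at [that r] available at every earlier [t]. *)
Lemma detOmega_le t z : a <= t -> t <= z -> z <= T ->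
  detOmega h1 h2 h3 a t <= detOmega h1 h2 h3 a z.
Proof.
move=> at_ tz zT; rewrite /detOmega.
have [-> -> ->] := omega_split (lexx a) at_ tz zT.
by apply: det_le_addr; apply: omega_psd => //; exact: le_trans zT.
Qed.

Lemma omega_qform_sub s t z x y : a <= s -> s <= t -> t <= z -> z <= T ->
  qform (omega h1 t z) (omega h2 t z) (omega h3 t z) x y <=
  qform (omega h1 s z) (omega h2 s z) (omega h3 s z) x y.
Proof.
move=> as_ st tz zT; have [-> -> ->] := omega_split as_ st tz zT.
have := @qform_ge0 _ _ _ _ x y (omega_psd as_ (le_trans tz zT)).
rewrite /qform => ?; lra.
Qed.

(** The integral of the form [H] at [(x + l al, y + l be)] is a nonnegative quadratic in [l]; the
    inequality is its discriminant condition. *)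
Lemma cauchy_schwarz_qform s t x y al be : a <= s -> s <= t -> t <= T ->
  continuous_on a T x -> continuous_on a T y ->
  (al * int s t (fun z => x z * h1 z + y z * h3 z) +
   be * int s t (fun z => x z * h3 z + y z * h2 z)) ^+ 2 <=
  int s t (fun z => qform (h1 z) (h2 z) (h3 z) (x z) (y z)) *
  qform (omega h1 s t) (omega h2 s t) (omega h3 s t) al be.
Proof.
move=> as_ st tT cx cy.
have sub f : intg a T f -> intg s t f by exact: integrable_on_sub.
have [/sub I1 /sub I2] := integrable_on_lin cx cy.
have /sub Iq := integrable_on_qform cx cy.
have Ic : intg s t (fun z => qform (h1 z) (h2 z) (h3 z) al be).
  by apply/sub/integrable_on_qform => z; exact: cvg_cst.
apply: discriminant_le; first exact/qform_ge0/omega_psd.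
move=> l; rewrite -omega_qform// -!int_Z// -int_D; try exact: integrable_onZ.
have I3 : intg s t (fun z => al * (x z * h1 z + y z * h3 z) + be * (x z * h3 z + y z * h2 z)).
  by apply: integrable_onD; exact: integrable_onZ.
rewrite -int_Z// -int_D//; last exact: integrable_onZ.
rewrite -int_D//; [|by apply: integrable_onD => //; exact: integrable_onZ
                   |exact: integrable_onZ].
apply: int_ge0 => z; rewrite in_itv/= => /andP[sz zt].
have zI : z \in `[a, T] by rewrite in_itv/= (le_trans as_)// (le_trans zt).
have := @qform_ge0 _ _ _ _ (x z + l * al) (y z + l * be) (hpsd zI).
congr (0 <= _); rewrite /qform; ring.
Qed.

End HamiltonianIntegrals.

(** * Energy identities for the canonical system *)

(* [(u1 + i v1, u2 + i v2)] is the second row of the fundamental solution at [z = i r]. *)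
Section CanonicalSystem.
Set Implicit Arguments.
Unset Strict Implicit.
Variable R : realType.
Local Notation mu := (leb R).
Local Notation int s t f := (Rintegral mu `[s, t] f).
Local Notation intg := (@integrable_on R).
Variables (a T r : R) (h1 h2 h3 u1 u2 v1 v2 : R -> R).
Hypotheses (aT : a <= T) (r0 : 0 < r).
Hypotheses (Ih1 : intg a T h1) (Ih2 : intg a T h2) (Ih3 : intg a T h3).
Hypothesis hpsd : forall x, x \in `[a, T] -> psd_coef (h1 x) (h2 x) (h3 x).
Hypothesis pu1 : primitive a T u1 (fun s => r * (v1 s * h3 s + v2 s * h2 s)).
Hypothesis pu2 : primitive a T u2 (fun s => - r * (v1 s * h1 s + v2 s * h3 s)).
Hypothesis pv1 : primitive a T v1 (fun s => - r * (u1 s * h3 s + u2 s * h2 s)).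
Hypothesis pv2 : primitive a T v2 (fun s => r * (u1 s * h1 s + u2 s * h3 s)).
Hypotheses (u1a : u1 a = 0) (u2a : u2 a = 1) (v1a : v1 a = 0) (v2a : v2 a = 0).

Let q s x y := qform (h1 s) (h2 s) (h3 s) x y.
Let om x y s t := qform (omega h1 s t) (omega h2 s t) (omega h3 s t) x y.

Let cu1 := primitive_continuous aT pu1.
Let cu2 := primitive_continuous aT pu2.
Let cv1 := primitive_continuous aT pv1.
Let cv2 := primitive_continuous aT pv2.

(* [- Im (w1 conj(w2))] and [|w2|^2] for the row [(w1, w2)]. *)
Definition wronskian s := u1 s * v2 s - v1 s * u2 s.
Definition normsq22 s := u2 s ^+ 2 + v2 s ^+ 2.

(** This is [w H w^*]: as [H] is real symmetric, the mixed terms of real and imaginary parts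
    cancel. *)
Definition energy s := q s (u1 s) (u2 s) + q s (v1 s) (v2 s).

Lemma energy_ge0 s : s \in `[a, T] -> 0 <= energy s.
Proof. by move=> sI; rewrite addr_ge0//; exact/qform_ge0/hpsd. Qed.

Lemma integrable_energy : intg a T energy.
Proof. by apply: integrable_onD; exact: integrable_on_qform. Qed.

Lemma primitive_wronskian : primitive a T wronskian (fun s => r * energy s).
Proof.
have := primitiveD (primitiveM aT pu1 pv2) (primitiveZ (-1) (primitiveM aT pv1 pu2)).
apply: eq_primitive => s _; first by rewrite /wronskian; ring.
by rewrite /energy /q /qform; ring.
Qed.

Lemma wronskian_incr s t : a <= s -> s <= t -> t <= T ->
  wronskian t - wronskian s = r * int s t energy.
Proof.
move=> as_ st tT; rewrite (primitive_incr primitive_wronskian)// int_Z//.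
exact: integrable_on_sub integrable_energy.
Qed.

Lemma wronskian_ge0 s : s \in `[a, T] -> 0 <= wronskian s.
Proof.
rewrite in_itv/= => /andP[as_ sT].
have := wronskian_incr (lexx a) as_ sT.
rewrite {2}/wronskian u1a v1a !mul0r !subr0 => ->.
rewrite mulr_ge0 ?(ltW r0)// int_ge0// => z; rewrite in_itv/= => /andP[az zs].
by apply: energy_ge0; rewrite in_itv/= az (le_trans zs).
Qed.

Lemma primitive_normsq22 :
  primitive a T normsq22 (fun s => 2 * (r * h1 s * wronskian s)).
Proof.
have := primitiveD (primitiveM aT pu2 pu2) (primitiveM aT pv2 pv2).
apply: eq_primitive => s _; first by rewrite /normsq22; ring.
by rewrite /wronskian; ring.
Qed.

(** The derivative [2 r h1 Q] is nonnegative and the value at [a] is [1]. This is the hypothesis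
    that [primitive_ln] asks for. *)
Lemma normsq22_ge1 s : s \in `[a, T] -> 1 <= normsq22 s.
Proof.
rewrite in_itv/= => /andP[as_ sT].
have [_ ->//] := primitive_normsq22.
rewrite /normsq22 u2a v2a expr1n expr0n/= addr0 lerDl.
apply: int_ge0 => z; rewrite in_itv/= => /andP[az zs].
have zI : z \in `[a, T] by rewrite in_itv/= az (le_trans zs).
have [h10 _ _] := hpsd zI.
by rewrite !mulr_ge0 ?(ltW r0)// wronskian_ge0.
Qed.

Lemma primitive_ln_normsq22 :
  primitive a T (fun s => 2^-1 * ln (normsq22 s))
    (fun s => r * h1 s * wronskian s / normsq22 s).
Proof.
have := primitiveZ 2^-1 (primitive_ln aT primitive_normsq22 normsq22_ge1).
by apply: eq_primitive => s sI //; rewrite !mulrA mulVf// mul1r.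
Qed.

(** The combinations on the left are, up to sign, [r] times the real and imaginary parts of the
    integral of [w H (al, be)^T] over [[y, t]]. As [al] and [be] are arbitrary, the matrix of
    rotated increments is bounded by a multiple of [Omega]. *)
Lemma increment_le s y t al be : a <= s -> s <= y -> y <= t -> t <= T ->
  (al * (u2 t - u2 y) - be * (u1 t - u1 y)) ^+ 2 +
  (al * (v2 t - v2 y) - be * (v1 t - v1 y)) ^+ 2 <=
  r ^+ 2 * int s t energy * om al be s t.
Proof.
move=> as_ sy yt tT; have ay := le_trans as_ sy.
have sub f : intg a T f -> intg y t f by exact: integrable_on_sub.
have [/sub Iu1 /sub Iu2] := integrable_on_lin Ih1 Ih2 Ih3 cu1 cu2.
have [/sub Iv1 /sub Iv2] := integrable_on_lin Ih1 Ih2 Ih3 cv1 cv2.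
rewrite (primitive_incr pu1)// (primitive_incr pu2)//.
rewrite (primitive_incr pv1)// (primitive_incr pv2)// !int_Z//.
have CSu := cauchy_schwarz_qform Ih1 Ih2 Ih3 hpsd al be ay yt tT cu1 cu2.
have CSv := cauchy_schwarz_qform Ih1 Ih2 Ih3 hpsd al be ay yt tT cv1 cv2.
have Eyt : int y t energy =
    int y t (fun z => q z (u1 z) (u2 z)) + int y t (fun z => q z (v1 z) (v2 z)).
  by rewrite int_D//; apply: sub; exact: integrable_on_qform.
(* Both factors are enlarged to [[s, t]], which makes the bound uniform in [y]. *)
have Ele : int y t energy <= int s t energy.
  apply: int_sub_le => //; last exact: integrable_on_sub integrable_energy.
  move=> z; rewrite in_itv/= => /andP[sz zt].
  by apply: energy_ge0; rewrite in_itv/= (le_trans as_)// (le_trans zt).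
have E0 : 0 <= int y t energy.
  apply: int_ge0 => z; rewrite in_itv/= => /andP[yz zt].
  by apply: energy_ge0; rewrite in_itv/= (le_trans ay)// (le_trans zt).
have omle : om al be y t <= om al be s t by exact: (omega_qform_sub (a := a) (T := T)).
have om0 : 0 <= om al be y t by apply/qform_ge0/(omega_psd (a := a) (T := T)).
rewrite -mulrA (le_trans (y := r ^+ 2 * (int y t energy * om al be y t)))//.
  rewrite Eyt mulrDl mulrDr; apply: (le_trans _ (lerD
    (ler_wpM2l (sqr_ge0 r) CSu) (ler_wpM2l (sqr_ge0 r) CSv))).
  by rewrite le_eqVlt; apply/orP; left; apply/eqP; ring.
by rewrite ler_wpM2l ?sqr_ge0// ler_pM.
Qed.

(* Writing [w(t) = w(y) + (w(t) - w(y))] under the integral over [y], the increments are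
   controlled by [increment_le]. *)
Lemma final_qform_le s t : a <= s -> s <= t -> t <= T ->
  om (u1 t) (u2 t) s t + om (v1 t) (v2 t) s t <=
  (2 + 4 * (r ^+ 2 * detOmega h1 h2 h3 s t)) * int s t energy.
Proof.
move=> as_ st tT.
have sub f : intg a T f -> intg s t f by exact: integrable_on_sub.
have IE := sub _ integrable_energy.
set E := int s t energy; pose K := r ^+ 2 * E.
have Jc x y : intg s t (fun z => q z x y).
  by apply/sub/integrable_on_qform => // z; exact: cvg_cst.
have J1 := sub _ Ih1; have J2 := sub _ Ih2; have J3 := sub _ Ih3.
set o1 := omega h1 s t; set o2 := omega h2 s t; set o3 := omega h3 s t.
have JL : intg s t (fun z => o2 * h1 z + o1 * h2 z - 2 * o3 * h3 z).
  by apply: integrable_onB; [apply: integrable_onD|]; exact: integrable_onZ.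
(* The mixed term integrates to [2 det Omega], hence the [4]; the [2] comes from the parallelogram
   identity below. *)
have -> : (2 + 4 * (r ^+ 2 * detOmega h1 h2 h3 s t)) * E =
  int s t (fun z => 2 * energy z + 2 * K * (o2 * h1 z + o1 * h2 z - 2 * o3 * h3 z)).
  rewrite int_D; [|exact: integrable_onZ..].
  rewrite !int_Z// int_B; [|by apply: integrable_onD; exact: integrable_onZ
                           |exact: integrable_onZ].
  rewrite (@int_D _ _ _ (fun z => o2 * h1 z)); [|exact: integrable_onZ..].
  rewrite !int_Z// -/E -/(omega h1 s t) -/(omega h2 s t) -/(omega h3 s t).
  by rewrite -/o1 -/o2 -/o3 /detOmega -/o1 -/o2 -/o3 /K; ring.
rewrite /om -!(omega_qform Ih1 Ih2 Ih3)// -int_D; [|exact: Jc..].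
apply: le_int; [by apply: integrable_onD; exact: Jc|by apply: integrable_onD; exact: integrable_onZ|].
move=> z; rewrite in_itv/= => /andP[sz zt].
have zI : z \in `[a, T] by rewrite in_itv/= (le_trans as_)// (le_trans zt).
pose d1 := u1 t - u1 z; pose d2 := u2 t - u2 z.
pose e1 := v1 t - v1 z; pose e2 := v2 t - v2 z.
(* [K Omega] minus the rotated matrix of increments; pairing it with [H] through [qform_adj_ge0]
   bounds [q(d) + q(e)] by [K] times the mixed term. *)
have A : psd_coef (K * o1 - (d2 ^+ 2 + e2 ^+ 2)) (K * o2 - (d1 ^+ 2 + e1 ^+ 2))
                  (K * o3 + (d1 * d2 + e1 * e2)).
  apply: psd_coefP => al be.
  have := increment_le al be as_ sz zt tT; rewrite -subr_ge0 -/E -/K.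
  rewrite -/d1 -/d2 -/e1 -/e2; congr (0 <= _).
  by rewrite /om /qform -/o1 -/o2 -/o3; ring.
have B := qform_adj_ge0 (hpsd zI) A.
have C := @qform_ge0 _ _ _ _ (u1 z - d1) (u2 z - d2) (hpsd zI).
have D := @qform_ge0 _ _ _ _ (v1 z - e1) (v2 z - e2) (hpsd zI).
rewrite -subr_ge0.
(* Parallelogram identity [q(w(t)) = 2 q(w(z)) + 2 q(d) - q(w(z) - d)], for the real and the
   imaginary part. *)
have -> : 2 * energy z + 2 * K * (o2 * h1 z + o1 * h2 z - 2 * o3 * h3 z) -
    (qform (h1 z) (h2 z) (h3 z) (u1 t) (u2 t) + qform (h1 z) (h2 z) (h3 z) (v1 t) (v2 t)) =
    2 * ((K * o1 - (d2 ^+ 2 + e2 ^+ 2)) * h2 z + (K * o2 - (d1 ^+ 2 + e1 ^+ 2)) * h1 z -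
         2 * (K * o3 + (d1 * d2 + e1 * e2)) * h3 z) +
    qform (h1 z) (h2 z) (h3 z) (u1 z - d1) (u2 z - d2) +
    qform (h1 z) (h2 z) (h3 z) (v1 z - e1) (v2 z - e2).
  by rewrite /energy /q /qform /d1 /d2 /e1 /e2; ring.
apply: addr_ge0 => //; apply: addr_ge0 => //; exact: mulr_ge0.
Qed.

End CanonicalSystem.

(** * Algebraic comparison of [Q] and [N] at a fixed point *)

Section PointwiseBounds.
Set Implicit Arguments.
Unset Strict Implicit.
Variable R : realType.
Variables (cm cp r : R) (u1 u2 v1 v2 o1 o2 o3 : R).
Hypotheses (cm0 : 0 < cm) (cp0 : 0 < cp) (r0 : 0 < r).
Let Q := u1 * v2 - v1 * u2.
Let N := u2 ^+ 2 + v2 ^+ 2.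
Let M := 2 + 4 * cp.
Hypotheses (Q0 : 0 <= Q) (Opsd : psd_coef o1 o2 o3).
Hypothesis X : r * (qform o1 o2 o3 u1 u2 + qform o1 o2 o3 v1 v2) <= M * Q.

Let M0 : 0 < M. Proof. by rewrite addr_gt0 ?mulr_gt0. Qed.
Let N0 : 0 <= N. Proof. by rewrite addr_ge0 ?sqr_ge0. Qed.

Lemma lagrange_le (x1 x2 y1 y2 : R) :
  (x1 * y2 - x2 * y1) ^+ 2 <= (x1 ^+ 2 + x2 ^+ 2) * (y1 ^+ 2 + y2 ^+ 2).
Proof.
have := sqr_ge0 (x1 * y1 + x2 * y2); rewrite -subr_ge0 => H; rewrite -subr_ge0.
move: H; congr (0 <= _); ring.
Qed.

(** Completing the square, [o1] times [w Omega w^*] is [|x|^2 + det Omega N], with [x] the first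
    entry of [w Omega]. Dropping [|x|^2] leaves the first bound; dropping the determinant leaves the
    second, since [Im(x conj(w2)) = - o1 Q]. *)
Lemma bounds_after : cm / r ^+ 2 <= o1 * o2 - o3 ^+ 2 ->
  cm * N <= M * (r * Q * o1) /\ r * Q * o1 <= M * N.
Proof.
move=> D; have [p10 p20 _] := Opsd.
set x1 := u1 * o1 + u2 * o3; set x2 := v1 * o1 + v2 * o3.
have E : (qform o1 o2 o3 u1 u2 + qform o1 o2 o3 v1 v2) * o1 =
  (x1 ^+ 2 + x2 ^+ 2) + (o1 * o2 - o3 ^+ 2) * N.
  by rewrite /qform /x1 /x2 /N; ring.
have XE : r * (x1 ^+ 2 + x2 ^+ 2) + r * ((o1 * o2 - o3 ^+ 2) * N) <= M * Q * o1.
  by rewrite -mulrDr -E mulrA ler_wpM2r.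
have x0 : 0 <= x1 ^+ 2 + x2 ^+ 2 by rewrite addr_ge0 ?sqr_ge0.
have rcm : r ^+ 2 * (cm / r ^+ 2) = cm by field; rewrite gt_eqF.
split.
  have : r ^+ 2 * (cm / r ^+ 2) * N <= r * (M * Q * o1).
    have -> : r ^+ 2 * (cm / r ^+ 2) * N = r * (r * (cm / r ^+ 2 * N)) by ring.
    rewrite ler_pM2l// (le_trans _ XE)// -[leLHS]add0r lerD//.
      by rewrite mulr_ge0// ltW.
    by rewrite ler_pM2l// ler_wpM2r.
  by rewrite rcm => /le_trans; apply; rewrite le_eqVlt; apply/orP; left; apply/eqP; ring.
have det0 : 0 <= o1 * o2 - o3 ^+ 2 by rewrite (le_trans _ D)// divr_ge0 ?sqr_ge0// ltW.
have H : r * (x1 ^+ 2 + x2 ^+ 2) <= M * Q * o1.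
  by rewrite (le_trans _ XE)// lerDl mulr_ge0 ?mulr_ge0// ltW.
have L := lagrange_le x1 x2 u2 v2.
have xQ : x1 * v2 - x2 * u2 = o1 * Q by rewrite /x1 /x2 /Q; ring.
rewrite xQ -/N in L.
have [oQ|oQ] := eqVneq (o1 * Q) 0.
  by rewrite -mulrA [Q * _]mulrC oQ mulr0 mulr_ge0// ltW.
have oQ0 : 0 < o1 * Q by rewrite lt_neqAle eq_sym oQ mulr_ge0.
rewrite -(ler_pM2l oQ0).
have -> : o1 * Q * (r * Q * o1) = r * (o1 * Q) ^+ 2 by ring.
apply: (le_trans (ler_wpM2l (ltW r0) L)).
have -> : o1 * Q * (M * N) = M * Q * o1 * N by ring.
by rewrite mulrA ler_wpM2r.
Qed.

(** Mirror image of [bounds_after]: the form is multiplied by [o2], and [x] is the second entry of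
    [w Omega]. The determinant may be arbitrarily small here, so the hypothesis on [w1] takes
    over. *)
Lemma bounds_before : u1 ^+ 2 + v1 ^+ 2 <= r * o2 * Q ->
  cp * (o2 * N) <= 2 * (M + cp) * (r * Q * (cp / r ^+ 2 + o3 ^+ 2)) /\
  r * Q * (cp / r ^+ 2 + o3 ^+ 2) <= (cp + M) * (o2 * N).
Proof.
move=> P; have [p10 p20 o3l] := Opsd.
set x1 := u2 * o2 + u1 * o3; set x2 := v2 * o2 + v1 * o3.
have E : (qform o1 o2 o3 u1 u2 + qform o1 o2 o3 v1 v2) * o2 =
  (x1 ^+ 2 + x2 ^+ 2) + (o1 * o2 - o3 ^+ 2) * (u1 ^+ 2 + v1 ^+ 2).
  by rewrite /qform /x1 /x2; ring.
have det0 : 0 <= o1 * o2 - o3 ^+ 2 by rewrite subr_ge0.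
have H : r * (x1 ^+ 2 + x2 ^+ 2) <= M * Q * o2.
  apply: (le_trans _ (ler_wpM2r p20 X)).
  rewrite -mulrA E ler_pM2l// lerDl mulr_ge0// addr_ge0 ?sqr_ge0//.
have rr : r ^+ 2 * (cp / r ^+ 2 + o3 ^+ 2) = cp + r ^+ 2 * o3 ^+ 2.
  by field; rewrite gt_eqF.
split.
  have [->|o2n] := eqVneq o2 0.
    have c0 : 0 <= cp / r ^+ 2 + o3 ^+ 2.
      by rewrite addr_ge0 ?sqr_ge0// divr_ge0 ?sqr_ge0// ltW.
    have Mc : 0 <= M + cp by rewrite addr_ge0// ltW.
    by rewrite mul0r mulr0 !mulr_ge0// ltW.
  have o2p : 0 < o2 by rewrite lt_neqAle eq_sym o2n.
  (* As [o2 w2 = x - o3 w1], this is [|x - y|^2 <= 2 |x|^2 + 2 |y|^2] with [y = o3 w1]. *)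
  have S : o2 ^+ 2 * N <= 2 * (x1 ^+ 2 + x2 ^+ 2) + 2 * (o3 ^+ 2 * (u1 ^+ 2 + v1 ^+ 2)).
    rewrite -subr_ge0.
    have -> : 2 * (x1 ^+ 2 + x2 ^+ 2) + 2 * (o3 ^+ 2 * (u1 ^+ 2 + v1 ^+ 2)) - o2 ^+ 2 * N
      = (u2 * o2 + 2 * (u1 * o3)) ^+ 2 + (v2 * o2 + 2 * (v1 * o3)) ^+ 2.
      by rewrite /x1 /x2 /N; ring.
    by rewrite addr_ge0 ?sqr_ge0.
  have S2 : r * o2 * N <= 2 * Q * (M + r ^+ 2 * o3 ^+ 2).
    rewrite -(ler_pM2l o2p).
    have -> : o2 * (r * o2 * N) = r * (o2 ^+ 2 * N) by ring.
    apply: (le_trans (ler_wpM2l (ltW r0) S)).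
    have -> : o2 * (2 * Q * (M + r ^+ 2 * o3 ^+ 2)) =
      2 * (M * Q * o2) + 2 * (r * o3 ^+ 2) * (r * o2 * Q) by ring.
    have -> : r * (2 * (x1 ^+ 2 + x2 ^+ 2) + 2 * (o3 ^+ 2 * (u1 ^+ 2 + v1 ^+ 2))) =
      2 * (r * (x1 ^+ 2 + x2 ^+ 2)) + 2 * (r * o3 ^+ 2) * (u1 ^+ 2 + v1 ^+ 2) by ring.
    apply: lerD; rewrite ler_wpM2l//.
    by apply: mulr_ge0 => //; exact: mulr_ge0 (ltW r0) (sqr_ge0 _).
  rewrite -(ler_pM2l r0).
  have -> : r * (cp * (o2 * N)) = cp * (r * o2 * N) by ring.
  apply: (le_trans (ler_wpM2l (ltW cp0) S2)).
  have -> : r * (2 * (M + cp) * (r * Q * (cp / r ^+ 2 + o3 ^+ 2))) =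
    2 * Q * ((M + cp) * (r ^+ 2 * (cp / r ^+ 2 + o3 ^+ 2))) by ring.
  rewrite rr; have -> : cp * (2 * Q * (M + r ^+ 2 * o3 ^+ 2)) =
    2 * Q * (cp * (M + r ^+ 2 * o3 ^+ 2)) by ring.
  rewrite ler_wpM2l ?mulr_ge0// -subr_ge0.
  have -> : (M + cp) * (cp + r ^+ 2 * o3 ^+ 2) - cp * (M + r ^+ 2 * o3 ^+ 2) =
    cp ^+ 2 + M * (r ^+ 2 * o3 ^+ 2) by ring.
  by rewrite addr_ge0 ?sqr_ge0// mulr_ge0 ?(ltW M0)// mulr_ge0 ?sqr_ge0.
have [->|Qn] := eqVneq Q 0.
  rewrite mulr0 mul0r mulr_ge0 ?mulr_ge0// addr_ge0// ltW//.
have Qp : 0 < Q by rewrite lt_neqAle eq_sym Qn.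
(* [Q] is at most [|w1| |w2|]; after inserting [P], one factor [Q] cancels. *)
have L1 : Q <= r * (o2 * N).
  rewrite -(ler_pM2l Qp) -expr2.
  apply: (le_trans (lagrange_le u1 v1 u2 v2)).
  have -> : Q * (r * (o2 * N)) = r * o2 * Q * N by ring.
  by rewrite ler_wpM2r.
(* Here [Im(x conj(w2))] is [- o3 Q], and [H] bounds [|x|^2]. *)
have L2 : r * o3 ^+ 2 * Q <= M * (o2 * N).
  rewrite -(ler_pM2l Qp).
  have -> : Q * (r * o3 ^+ 2 * Q) = r * (x2 * u2 - x1 * v2) ^+ 2.
    by rewrite /x1 /x2 /Q; ring.
  have := lagrange_le x2 x1 v2 u2.
  have -> : Q * (M * (o2 * N)) = M * Q * o2 * N by ring.
  move=> L; apply: (le_trans (ler_wpM2l (ltW r0) L)).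
  by rewrite [x2 ^+ 2 + _]addrC [v2 ^+ 2 + _]addrC mulrA ler_wpM2r.
rewrite -(ler_pM2l r0).
have -> : r * (r * Q * (cp / r ^+ 2 + o3 ^+ 2)) =
  Q * (r ^+ 2 * (cp / r ^+ 2 + o3 ^+ 2)) by ring.
rewrite rr.
have -> : Q * (cp + r ^+ 2 * o3 ^+ 2) = cp * Q + r * (r * o3 ^+ 2 * Q) by ring.
have -> : r * ((cp + M) * (o2 * N)) = cp * (r * (o2 * N)) + r * (M * (o2 * N)) by ring.
by rewrite lerD// ler_wpM2l// ltW.
Qed.

End PointwiseBounds.

(** * Pointwise comparison of the kernel with the logarithmic derivative *)

Section KernelBounds.
Set Implicit Arguments.
Unset Strict Implicit.
Variable R : realType.
Local Notation intg := (@integrable_on R).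

(** One entry per branch of the kernel: the first from [bounds_after], the second from
    [bounds_before]. *)
Definition lower_const (cm cp : R) : R :=
  Num.min (cm / (2 + 4 * cp)) (cp / (2 * (2 + 4 * cp + cp))).

Lemma lower_const_gt0 cm cp : 0 < cm -> 0 < cp -> 0 < lower_const cm cp.
Proof.
move=> cm0 cp0; have M0 : 0 < 2 + 4 * cp by rewrite addr_gt0 ?mulr_gt0.
by rewrite /lower_const lt_min !divr_gt0// mulr_gt0// addr_gt0.
Qed.

Variables (a : R) (b : \bar R) (cm cp r0 r : R) (h1 h2 h3 u1 u2 v1 v2 : R -> R).
Variables (that : R -> R) (shat : R -> R -> R).
Hypotheses (cm0 : 0 < cm) (cp0 : 0 < cp) (r00 : 0 <= r0) (r0r : r0 < r).
Hypothesis Ih : forall T, (T%:E < b)%E -> [/\ intg a T h1, intg a T h2 & intg a T h3].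
Hypothesis hpsd : forall x, psd_coef (h1 x) (h2 x) (h3 x).
Hypothesis cpair : compatible_pair a b h1 h2 h3 r0 cm cp that shat.
Hypothesis sol : forall T, a <= T -> (T%:E < b)%E ->
  [/\ primitive a T u1 (fun s => r * (v1 s * h3 s + v2 s * h2 s)),
      primitive a T u2 (fun s => - r * (v1 s * h1 s + v2 s * h3 s)),
      primitive a T v1 (fun s => - r * (u1 s * h3 s + u2 s * h2 s)) &
      primitive a T v2 (fun s => r * (u1 s * h1 s + u2 s * h3 s))].
Hypotheses (u1a : u1 a = 0) (u2a : u2 a = 1) (v1a : v1 a = 0) (v2a : v2 a = 0).

Let r_gt0 : 0 < r. Proof. exact: le_lt_trans r0r. Qed.
Let M := 2 + 4 * cp.
Let M0 : 0 < M. Proof. by rewrite addr_gt0 ?mulr_gt0. Qed.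

(** The derivative of [ln |w_22|], that is, half the logarithmic derivative of [normsq22]. *)
Definition log_density s :=
  r * h1 s * wronskian u1 u2 v1 v2 s / normsq22 u2 v2 s.

Let Q s := wronskian u1 u2 v1 v2 s.
Let N s := normsq22 u2 v2 s.

Lemma normsq22_ge1_dom t : Ia_b a b t -> 1 <= N t.
Proof.
move=> [at_ tb]; have [I1 I2 I3] := Ih tb; have [p1 p2 p3 p4] := sol at_ tb.
apply: (normsq22_ge1 at_ r_gt0 I1 I2 I3 _ p1 p2 p3 p4) => //.
by rewrite in_itv/= at_ lexx.
Qed.

Lemma wronskian_ge0_dom t : Ia_b a b t -> 0 <= Q t.
Proof.
move=> [at_ tb]; have [I1 I2 I3] := Ih tb; have [p1 p2 p3 p4] := sol at_ tb.
apply: (wronskian_ge0 at_ r_gt0 I1 I2 I3 _ p1 p2 p3 p4) => //.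
by rewrite in_itv/= at_ lexx.
Qed.

Lemma log_density_ge0 t : Ia_b a b t -> 0 <= log_density t.
Proof.
move=> tI; have [h10 _ _] := hpsd t.
have N1 := normsq22_ge1_dom tI.
apply: divr_ge0; last exact: le_trans N1.
by rewrite mulr_ge0 ?wronskian_ge0_dom// mulr_ge0// ltW.
Qed.

(** [r] times the energy over [[s, t]] is [Q t - Q s], at most [Q t]; the bound on the determinant
    makes the constant independent of [r]. *)
Lemma final_qform_wronskian_le s t : a <= s -> s <= t -> (t%:E < b)%E ->
  detOmega h1 h2 h3 s t <= cp / r ^+ 2 ->
  r * (qform (omega h1 s t) (omega h2 s t) (omega h3 s t) (u1 t) (u2 t) +
       qform (omega h1 s t) (omega h2 s t) (omega h3 s t) (v1 t) (v2 t)) <= M * Q t.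
Proof.
move=> as_ st tb D; have at_ := le_trans as_ st.
have [I1 I2 I3] := Ih tb; have [p1 p2 p3 p4] := sol at_ tb.
have F := final_qform_le at_ I1 I2 I3 (fun x _ => hpsd x) p1 p2 p3 p4 as_ st (lexx t).
have W := wronskian_incr at_ I1 I2 I3 p1 p2 p3 p4 as_ st (lexx t).
have Qs : 0 <= Q s by apply: wronskian_ge0_dom; split=> //; apply: le_lt_trans tb; rewrite lee_fin.
have D' : 2 + 4 * (r ^+ 2 * detOmega h1 h2 h3 s t) <= M.
  rewrite lerD2l ler_pM2l// -[leRHS](_ : r ^+ 2 * (cp / r ^+ 2) = _).
    by rewrite ler_pM2l// exprn_gt0.
  by field; rewrite gt_eqF.
apply: (le_trans (ler_wpM2l (ltW r_gt0) F)); rewrite mulrCA -W.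
have W0 : 0 <= Q t - Q s.
  rewrite /Q W mulr_ge0 ?(ltW r_gt0)// int_ge0// => z _.
  by rewrite /energy addr_ge0//; exact: qform_ge0.
apply: (le_trans (ler_wpM2r W0 D')).
by rewrite ler_pM2l// gerBl.
Qed.

(** Kernel and density share the factor [h1 t], so it suffices to compare the cofactors, also where
    [h1] vanishes. *)
Lemma kernel_bounds t : Ia_b a b t ->
  let K := kernelK a b h1 h2 h3 cp that shat t r in
  [/\ 0 <= K, lower_const cm cp * K <= log_density t & log_density t <= (cp + M) * K].
Proof.
move=> tI; have [at_ tb] := tI; have [h10 _ _] := hpsd t.
have [C1 C2] := cpair.
have [[athat thatb] /andP[_ dthat]] := C1 r r0r.
have N0 : 0 < N t by apply: lt_le_trans (normsq22_ge1_dom tI).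
have Q0 := wronskian_ge0_dom tI.
have gE : log_density t = h1 t * (r * Q t / N t).
  by rewrite /log_density -/(Q t) -/(N t); ring.
rewrite /kernelK at_ tb andbT /=.
have [tt|tt] := ltP t (that r).
  rewrite addr0.
  have [I1 I2 I3] := Ih thatb.
  have D : detOmega h1 h2 h3 a t <= cp / r ^+ 2.
    apply: le_trans dthat.
    by apply: (detOmega_le I1 I2 I3) => //; rewrite ltW.
  have X := final_qform_wronskian_le (lexx a) at_ tb D.
  have [J1 J2 J3] := Ih tb; have [p1 p2 p3 p4] := sol at_ tb.
  have Op : psd_coef (omega h1 a t) (omega h2 a t) (omega h3 a t).
    exact: (omega_psd J1 J2 J3).
  (* The direction [(al, be) = (0, 1)] with [s = y = a] isolates [w1], which vanishes at [a], as
     does [Q]. *)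
  have P : u1 t ^+ 2 + v1 t ^+ 2 <= r * omega h2 a t * Q t.
    have := increment_le at_ J1 J2 J3 (fun x _ => hpsd x) p1 p2 p3 p4 0 1
      (lexx a) (lexx a) at_ (lexx t).
    have := wronskian_incr at_ J1 J2 J3 p1 p2 p3 p4 (lexx a) at_ (lexx t).
    rewrite u1a v1a !mul0r !mul1r !subr0 !sub0r !sqrrN -/(Q t) => W.
    have Qa : wronskian u1 u2 v1 v2 a = 0 by rewrite /wronskian u1a v1a !mul0r subr0.
    rewrite Qa subr0 in W.
    move=> /le_trans; apply; rewrite expr2 -[r * r * _]mulrA -W.
    rewrite le_eqVlt; apply/orP; left; apply/eqP; rewrite /qform; ring.
  have [B1 B2] := bounds_before cp0 r_gt0 Q0 Op X P.
  have [_ o2 _] := Op.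
  set den := cp / r ^+ 2 + omega h3 a t ^+ 2 in B1 B2 *.
  have den0 : 0 < den by rewrite ltr_pwDl ?sqr_ge0// divr_gt0// exprn_gt0.
  have Mc : 0 < M + cp by rewrite addr_gt0.
  have Mc0 : 0 < 2 * (M + cp) by rewrite mulr_gt0// addr_gt0.
  have KE : omega h2 a t * h1 t / den = h1 t * (omega h2 a t / den) by ring.
  rewrite KE gE; split.
  - by rewrite mulr_ge0// divr_ge0// ltW.
  - rewrite mulrCA ler_wpM2l//.
    apply: (@le_trans _ _ (cp / (2 * (M + cp)) * (omega h2 a t / den))).
      by rewrite ler_wpM2r ?divr_ge0 ?(ltW den0)// /lower_const ge_min lexx orbT.
    rewrite -subr_ge0.
    have -> : r * Q t / N t - cp / (2 * (M + cp)) * (omega h2 a t / den) =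
      (2 * (M + cp) * (r * Q t * den) - cp * (omega h2 a t * N t)) /
        (2 * (M + cp) * den * N t).
      by field; rewrite !gt_eqF.
    by rewrite divr_ge0 ?subr_ge0// !mulr_ge0 ?(ltW den0) ?(ltW N0)// addr_ge0// ltW.
  - rewrite [leRHS]mulrCA ler_wpM2l//.
    rewrite -subr_ge0.
    have -> : (cp + M) * (omega h2 a t / den) - r * Q t / N t =
      ((cp + M) * (omega h2 a t * N t) - r * Q t * den) / (den * N t).
      by field; rewrite !gt_eqF.
    by rewrite divr_ge0 ?subr_ge0// mulr_ge0// ltW.
rewrite add0r.
have at' : Iab a b t by split=> //; exact: lt_le_trans athat tt.
have [as_ _ st /andP[D1 D2]] := C2 r t r0r at' tt.
have X := final_qform_wronskian_le as_ st tb D2.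
have [J1 J2 J3] := Ih tb.
set s := shat t r in as_ st D1 D2 X *.
have Op : psd_coef (omega h1 s t) (omega h2 s t) (omega h3 s t).
  exact: (omega_psd J1 J2 J3).
have [B1 B2] := bounds_after cm0 cp0 r_gt0 Q0 Op X D1.
have [p1 _ _] := Op.
(* The positive lower bound on the determinant excludes a zero denominator in the kernel. *)
have o1p : 0 < omega h1 s t.
  rewrite lt_neqAle p1 andbT; apply/eqP => o10.
  have : 0 < detOmega h1 h2 h3 s t by apply: lt_le_trans D1; rewrite divr_gt0// exprn_gt0.
  by rewrite /detOmega -o10 mul0r sub0r oppr_gt0 ltNge sqr_ge0.
rewrite gE; split.
- by rewrite divr_ge0.
- rewrite mulrCA ler_wpM2l//.
  apply: (@le_trans _ _ (cm / M / omega h1 s t)).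
    by rewrite ler_wpM2r ?invr_ge0// /lower_const ge_min lexx.
  rewrite -subr_ge0.
  have -> : r * Q t / N t - cm / M / omega h1 s t =
    (M * (r * Q t * omega h1 s t) - cm * N t) / (M * omega h1 s t * N t).
    by field; rewrite !gt_eqF.
  by rewrite divr_ge0 ?subr_ge0// !mulr_ge0// ltW.
- rewrite [leRHS]mulrCA ler_wpM2l//.
  apply: (@le_trans _ _ (M / omega h1 s t)); last first.
    by rewrite ler_wpM2r ?invr_ge0// lerDr ltW.
  rewrite -subr_ge0.
  have -> : M / omega h1 s t - r * Q t / N t =
    (M * N t - r * Q t * omega h1 s t) / (omega h1 s t * N t).
    by field; rewrite !gt_eqF.
  by rewrite divr_ge0 ?subr_ge0// mulr_ge0// ltW.
Qed.

Lemma ln_cmod (x y : R) : 1 <= x ^+ 2 + y ^+ 2 ->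
  ln (cmod x y) = 2^-1 * ln (x ^+ 2 + y ^+ 2).
Proof.
move=> N1; have N0 : 0 < x ^+ 2 + y ^+ 2 by exact: lt_le_trans N1.
rewrite /cmod -[in RHS](@sqr_sqrtr _ (x ^+ 2 + y ^+ 2)) ?ltW//.
by rewrite lnXn ?sqrtr_gt0// -[ln _ *+ 2]mulr_natl mulrA mulVf ?mul1r.
Qed.

Lemma integral_log_density x : Ia_b a b x ->
  integrable_on a x log_density /\
  (\int[leb R]_(t in `[a, x]) (log_density t)%:E = (ln (cmod (u2 x) (v2 x)))%:E)%E.
Proof.
move=> xI; have [ax xb] := xI.
have [I1 I2 I3] := Ih xb; have [p1 p2 p3 p4] := sol ax xb.
have pl := primitive_ln_normsq22 ax r_gt0 I1 I2 I3 (fun x _ => hpsd x)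
  p1 p2 p3 p4 u1a u2a v1a v2a.
have [Il Hl] := pl; split=> //.
rewrite ln_cmod; last exact: normsq22_ge1_dom xI.
rewrite -[LHS]fineK; last by apply: integrable_fin_num => //; exact: measurable_itv.
congr (_%:E); have := Hl x ax (lexx x).
by rewrite /normsq22 u2a v2a expr1n expr0n/= addr0 ln1 mulr0 add0r => ->.
Qed.

End KernelBounds.

(** * Comparison of integrals without measurability *)

(* The kernel need not be measurable, since [shat] is arbitrary. Its integral is then a
   supremum over simple functions, and the comparison lemmas below are stated without
   measurability hypotheses. *)
Section NonmeasurableIntegral.
Set Implicit Arguments.
Unset Strict Implicit.
Context d (T : measurableType d) (R : realType).
Variable mu : {measure set T -> \bar R}.
Variable N : set T.
Hypotheses (mN : measurable N) (muN : mu N = 0%E).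
Implicit Types (D : set T) (f g : T -> \bar R).
Import HBNNSimple.

(** A simple function below [f], set to [0] on [N], keeps its integral and lies below [g]. *)
Lemma ge0_le_integral_off_null D f g :
  (forall x, D x -> 0 <= f x)%E -> (forall x, D x -> 0 <= g x)%E ->
  (forall x, D x -> ~ N x -> f x <= g x)%E ->
  (\int[mu]_(x in D) f x <= \int[mu]_(x in D) g x)%E.
Proof.
move=> f0 g0 fg; rewrite !ge0_integralE//.
apply: ge_ereal_sup => _ [h hf <-].
have mNC : measurable (~` N) by exact: measurableC.
have hE x : proj_nnsfun h mNC x = if x \in N then 0 else h x.
  rewrite /proj_nnsfun /= /indic_nnsfun mindicE in_setC.
  by case: (x \in N); rewrite ?mulr0 ?mulr1.
have -> : sintegral mu h = sintegral mu (proj_nnsfun h mNC).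
  rewrite -!integralT_nnsfun; apply: ge0_ae_eq_integral => //.
  - exact/measurable_EFinP.
  - exact/measurable_EFinP.
  - by move=> x _; rewrite lee_fin.
  - by move=> x _; rewrite lee_fin.
  exists N; split=> // x /= /not_implyP[_]; apply: contra_notP => nN.
  congr (_%:E); apply/esym; rewrite [LHS]hE ifN//.
  by apply/negP => /set_mem.
apply: ereal_sup_ubound; exists (proj_nnsfun h mNC) => //= x.
rewrite [X in (X%:E <= _)%E](_ : _ = if x \in N then 0 else h x); last exact: hE.
move: (hf x); rewrite /patch.
have [xD|xD] := boolP (x \in D); have [xN|xN] := boolP (x \in N) => //.
  by move=> _; apply/g0/set_mem.
move=> /le_trans; apply; apply: fg; first exact: set_mem.
by move=> /mem_set; apply/negP.
Qed.

Lemma eq_integral_off_null D f g :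
  (forall x, D x -> ~ N x -> f x = g x) ->
  (\int[mu]_(x in D) f x = \int[mu]_(x in D) g x)%E.
Proof.
move=> fg; rewrite integralE [RHS]integralE; congr (_ - _)%E; apply/eqP;
rewrite eq_le; apply/andP; split; apply: ge0_le_integral_off_null => // x xD xN;
by rewrite ?(funeposE, funenegE) fg.
Qed.

(** The constants are moved onto [g]: pulling a scalar out of the integral uses measurability, which
    [k] may lack. *)
Lemma integral_sandwich D (k g : T -> R) (c1 c2 : R) : measurable D ->
  0 < c1 -> 0 < c2 -> measurable_fun D g ->
  (forall x, D x -> 0 <= k x) -> (forall x, D x -> 0 <= g x) ->
  (forall x, D x -> c1 * k x <= g x <= c2 * k x) ->
  (c1%:E * \int[mu]_(x in D) (k x)%:E <= \int[mu]_(x in D) (g x)%:E <=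
   c2%:E * \int[mu]_(x in D) (k x)%:E)%E.
Proof.
move=> mD c10 c20 mg k0 g0 H.
have mg' : measurable_fun D (EFin \o g) by exact/measurable_EFinP.
have g0' x : D x -> (0 <= (g x)%:E)%E by move=> Dx; rewrite lee_fin g0.
have c10' : 0 <= c1^-1 by rewrite invr_ge0 ltW.
have c20' : 0 <= c2^-1 by rewrite invr_ge0 ltW.
rewrite -lee_pdivlMl// -[X in (_ && X)]lee_pdivrMl//.
rewrite -(ge0_integralZl_EFin mu mD g0' mg' c10').
rewrite -(ge0_integralZl_EFin mu mD g0' mg' c20').
by apply/andP; split; apply: ge0_le_integral_off_null => x Dx; rewrite -?EFinM ?lee_fin;
  rewrite ?k0 ?mulr_ge0 ?g0// => _; have /andP[H1 H2] := H x Dx;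
  rewrite ?ler_pdivlMl// ?ler_pdivrMl.
Qed.

End NonmeasurableIntegral.

(** * Exhaustion of [[a, b)] by compact intervals *)

Section IntervalTowardB.
Set Implicit Arguments.
Unset Strict Implicit.
Variable R : realType.
Variables (a : R) (b : \bar R).
Hypothesis ab : (a%:E < b)%E.

Lemma measurable_Iab : measurable (Iab a b : set (measurableTypeR R)).
Proof.
case: b => [c| |].
- rewrite (_ : Iab a c%:E = `]a, c[%classic); first exact: measurable_itv.
  by apply/seteqP; split => x; rewrite /Iab /= in_itv/= lte_fin => /andP.
- rewrite (_ : Iab a +oo = `]a, +oo[%classic); first exact: measurable_itv.
  apply/seteqP; split => x; rewrite /Iab /= in_itv/= andbT; first by case.
  by move=> ax; split=> //; exact: ltry.
- by rewrite (_ : Iab a -oo = set0) //; apply/seteqP; split=> // x [].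
Qed.

Lemma Ia_bE : Ia_b a b = a |` Iab a b.
Proof.
apply/seteqP; split => [x [ax xb]|x [->|[ax xb]]].
- by move: ax; rewrite le_eqVlt => /predU1P[->|ax]; [left|right].
- by split.
- by split => //; exact: ltW.
Qed.

Lemma measurable_Ia_b : measurable (Ia_b a b : set (measurableTypeR R)).
Proof. by rewrite Ia_bE; apply: measurableU => //; exact: measurable_Iab. Qed.

Lemma exists_between T : (T%:E < b)%E -> exists2 c, T < c & (c%:E < b)%E.
Proof.
case: b => [c| |] //.
  rewrite lte_fin => Tc; exists ((T + c) / 2); rewrite ?lte_fin; lra.
by move=> _; exists (T + 1); [lra|exact: ltry].
Qed.

Lemma exhausting_sequence : exists x : nat -> R,
  [/\ {homo x : m n / (m <= n)%N >-> m <= n},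
      forall n, Ia_b a b (x n),
      (forall t, (t%:E < b)%E -> exists n, t <= x n) &
      x @ \oo --> toward_b b].
Proof.
have [x [x_nd xI x_ex]] : exists x : nat -> R,
  [/\ {homo x : m n / (m <= n)%N >-> m <= n}, forall n, Ia_b a b (x n) &
      forall t, (t%:E < b)%E -> exists n, t <= x n].
  case: b ab => [c| |] //; rewrite ?lte_fin => ac.
    have ca : 0 < c - a by rewrite subr_gt0.
    exists (fun n => c - (c - a) / n.+1%:R); split.
    - move=> m n mn; rewrite lerD2l lerN2 ler_pM2l// lef_pV2 ?posrE//.
      by rewrite ler_nat.
    - move=> n; split.
        rewrite lerBrDl -lerBrDr ler_pdivrMr// ler_peMr ?(ltW ca)//.
        by rewrite ler1n.
      by rewrite lte_fin ltrBlDr ltrDl divr_gt0.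
    - move=> t; rewrite lte_fin => tc; have ct : 0 < c - t by rewrite subr_gt0.
      exists (Num.truncn ((c - a) / (c - t))).
      rewrite lerBrDl -lerBrDr ler_pdivrMr// -ler_pdivrMl// mulrC.
      by rewrite ltW// truncnS_gt.
  exists (fun n => a + n%:R); split.
  - by move=> m n mn; rewrite lerD2l ler_nat.
  - by move=> n; split; [rewrite lerDl|exact: ltry].
  - move=> t _; exists (Num.truncn (t - a)).+1.
    by rewrite -lerBlDl ltW// truncnS_gt.
exists x; split=> //.
have ev t : (t%:E < b)%E -> \forall n \near \oo, t <= x n.
  move=> /x_ex[n0 tn0]; exists n0 => // n /= n0n.
  exact: le_trans (x_nd _ _ n0n).
move=> P; case: b ab xI ev => [c| |] //; rewrite ?lte_fin => ac xI ev.
- move=> [e e0 Pe].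
  have := ev (c - e / 2); rewrite lte_fin ltrBlDr ltrDl divr_gt0// => /(_ isT).
  apply: filterS => n xn; have [_] := xI n; rewrite lte_fin => xc.
  apply: Pe => //; rewrite /ball /= gtr0_norm ?subr_gt0//.
  have : 0 < e by []. by lra.
- move=> [m [_ Pm]].
  have := ev (m + 1) (ltry _); apply: filterS => n xn; apply: Pm.
  by apply: lt_le_trans xn; rewrite ltrDl.
Qed.

End IntervalTowardB.

(** * Entries of the canonical system *)

Section Coefficients.
Set Implicit Arguments.
Unset Strict Implicit.
Variable R : realType.

Lemma psd_Hmat (h1 h2 h3 : R -> R) t :
  psd (Hmat h1 h2 h3 t) -> psd_coef (h1 t) (h2 t) (h3 t).
Proof.
move=> H; apply: psd_coefP => x y.
have := H (\col_(i < 2) if i == ord0 then x else y).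
rewrite !(mxE, big_ord_recl, big_ord0) /=.
by congr (0 <= _); rewrite /qform; ring.
Qed.

Lemma mulHJ_row (V : 'M[R]_2) (h1 h2 h3 : R -> R) t :
  (V *m Hmat h1 h2 h3 t *m Jmat R) ord_max ord0 =
    V ord_max ord0 * h3 t + V ord_max ord_max * h2 t /\
  (V *m Hmat h1 h2 h3 t *m Jmat R) ord_max ord_max =
    - (V ord_max ord0 * h1 t + V ord_max ord_max * h3 t).
Proof.
have e : lift ord0 ord0 = ord_max :> 'I_2 by exact/val_inj.
by split; rewrite !(mxE, big_ord_recl, big_ord0) /= e; ring.
Qed.

End Coefficients.

(** * Modification of [H] on a null set *)

(* Replacing [h] by [h \_ (Iab a b `\` A)] for a null set [A] makes the Hamiltonian
   nonnegative everywhere without changing any integral. *)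
Section OffNullSet.
Set Implicit Arguments.
Unset Strict Implicit.
Variable R : realType.
Variables (a : R) (b : \bar R) (A : set (measurableTypeR R)).
Hypotheses (ab : (a%:E < b)%E) (mA : measurable A) (leA : leb R A = 0%E).
Implicit Types h : R -> R.

(** The point [a] is added because the restriction to the open interval [Iab a b] is [0] there. *)
Definition null_or_left : set (measurableTypeR R) := A `|` [set a].
Local Notation G := (Iab a b `\` A).

Lemma measurable_null_or_left : measurable null_or_left.
Proof. exact: measurableU. Qed.

Lemma leb_null_or_left : leb R null_or_left = 0%E.
Proof. by rewrite measureU0 //; exact: lebesgue_measure_set1. Qed.

Let mG : measurable (G : set (measurableTypeR R)).
Proof. by apply: measurableD => //; exact: measurable_Iab. Qed.

Lemma restrict_off h x : Ia_b a b x -> ~ null_or_left x -> (h \_ G) x = h x.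
Proof.
rewrite Ia_bE// => -[->|xI] xN; first by case: xN; right.
by rewrite patchE mem_set//; split=> // Ax; apply: xN; left.
Qed.

Lemma Rintegral_restrict_off h s t : a <= s -> (t%:E < b)%E ->
  Rintegral (leb R) `[s, t] (h \_ G) = Rintegral (leb R) `[s, t] h.
Proof.
move=> as_ tb; congr fine.
apply: (eq_integral_off_null measurable_null_or_left leb_null_or_left) => x /=.
rewrite in_itv/= => /andP[sx xt] xN; rewrite restrict_off//; split.
  exact: le_trans sx.
by apply: le_lt_trans tb; rewrite lee_fin.
Qed.

Lemma integrable_restrict_off h T :
  integrable_on a T h -> integrable_on a T (h \_ G).
Proof.
move=> Ih; rewrite /integrable_on -restrict_EFin.
apply/integrable_restrict => //.
by apply: integrableS Ih => //; exact: measurableI.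
Qed.

Lemma integrable_restrict_Iab h T : (T%:E < b)%E ->
  (forall c, a < c -> (c%:E < b)%E -> (leb R).-integrable `]a, c[ (EFin \o h)) ->
  integrable_on a T (h \_ G).
Proof.
move=> Tb Ih.
have [c Mc cb] : exists2 c, Num.max a T < c & (c%:E < b)%E.
  by apply: exists_between; case: (leP a T).
move: Mc; rewrite gt_max => /andP[ac Tc].
rewrite /integrable_on -restrict_EFin; apply/integrable_restrict => //.
apply: (integrableS _ _ _ (Ih c ac cb)) => //; first exact: measurableI.
move=> x /= [+ [[ax _] _]]; rewrite !in_itv/= ax /= => /andP[_ xT].
exact: le_lt_trans Tc.
Qed.

(** [H] enters pointwise only at [t], otherwise through integrals whose left endpoint must not
    precede [a]; compatibility ensures this for [shat t r]. *)
Lemma kernelK_restrict_off (h1 h2 h3 : R -> R) cm cp r0 that shat t r :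
  compatible_pair a b h1 h2 h3 r0 cm cp that shat -> r0 < r ->
  Ia_b a b t -> ~ null_or_left t ->
  kernelK a b h1 h2 h3 cp that shat t r =
  kernelK a b (h1 \_ G) (h2 \_ G) (h3 \_ G) cp that shat t r.
Proof.
move=> [C1 C2] r0r tI tN; have [at_ tb] := tI.
rewrite /kernelK /omega !(restrict_off _ tI tN) at_ tb andbT /=.
have [tt|tt] := ltP t (that r); first by rewrite !Rintegral_restrict_off.
have [[athat _] _] := C1 r r0r.
have [|as_ _ _ _] := C2 r t r0r _ tt; first by split=> //; exact: lt_le_trans tt.
by rewrite !Rintegral_restrict_off.
Qed.

Lemma compatible_pair_restrict_off (h1 h2 h3 : R -> R) cm cp r0 that shat :
  compatible_pair a b h1 h2 h3 r0 cm cp that shat ->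
  compatible_pair a b (h1 \_ G) (h2 \_ G) (h3 \_ G) r0 cm cp that shat.
Proof.
move=> [C1 C2]; split=> [r r0r|r t r0r tI tt].
  have [[athat thatb] H] := C1 r r0r; split=> //.
  by rewrite /detOmega /omega !Rintegral_restrict_off.
have [as_ sb st H] := C2 r t r0r tI tt; split=> //.
by case: tI => ? ?; rewrite /detOmega /omega !Rintegral_restrict_off.
Qed.

(** The separate [k] allows the entries of [H] to be restricted inside an expression, instead of the
    whole expression. *)
Lemma primitive_restrict_off F h k T : a <= T -> (T%:E < b)%E ->
  (forall t, a <= t -> t <= T -> integrable_on a t h) ->
  (forall t, a <= t -> t <= T -> F t = F a + Rintegral (leb R) `[a, t] h) ->
  (h \_ G) =1 k -> primitive a T F k.
Proof.
move=> aT Tb Ih HF hk.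
apply: (@eq_primitive _ _ _ F (h \_ G)) => //; split.
  exact/integrable_restrict_off/Ih.
move=> t at_ tT; rewrite HF// Rintegral_restrict_off//.
by apply: le_lt_trans Tb; rewrite lee_fin.
Qed.

Lemma fundamental_solution_restrict_off (h1 h2 h3 : R -> R) r (U V : R -> 'M[R]_2) :
  fundamental_solution a b h1 h2 h3 r U V ->
  let u1 t := U t ord_max ord0 in let u2 t := U t ord_max ord_max in
  let v1 t := V t ord_max ord0 in let v2 t := V t ord_max ord_max in
  [/\ u1 a = 0, u2 a = 1, v1 a = 0 & v2 a = 0] /\
  forall T, a <= T -> (T%:E < b)%E ->
  [/\ primitive a T u1 (fun s => r * (v1 s * (h3 \_ G) s + v2 s * (h2 \_ G) s)),
      primitive a T u2 (fun s => - r * (v1 s * (h1 \_ G) s + v2 s * (h3 \_ G) s)),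
      primitive a T v1 (fun s => - r * (u1 s * (h3 \_ G) s + u2 s * (h2 \_ G) s)) &
      primitive a T v2 (fun s => r * (u1 s * (h1 \_ G) s + u2 s * (h3 \_ G) s))].
Proof.
move=> S u1 u2 v1 v2.
have S' t : a <= t -> (t%:E < b)%E ->
  [/\ [/\ integrable_on a t (fun s => v1 s * h3 s + v2 s * h2 s),
          integrable_on a t (fun s => - (v1 s * h1 s + v2 s * h3 s)),
          integrable_on a t (fun s => u1 s * h3 s + u2 s * h2 s) &
          integrable_on a t (fun s => - (u1 s * h1 s + u2 s * h3 s))],
      u1 t = r * Rintegral (leb R) `[a, t] (fun s => v1 s * h3 s + v2 s * h2 s),
      u2 t = 1 + r * Rintegral (leb R) `[a, t] (fun s => - (v1 s * h1 s + v2 s * h3 s)),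
      v1 t = - r * Rintegral (leb R) `[a, t] (fun s => u1 s * h3 s + u2 s * h2 s) &
      v2 t = - r * Rintegral (leb R) `[a, t] (fun s => - (u1 s * h1 s + u2 s * h3 s))].
  move=> at_ tb.
  have EU : (fun s => (U s *m Hmat h1 h2 h3 s *m Jmat R) ord_max ord0) =
            (fun s => u1 s * h3 s + u2 s * h2 s).
    by apply/funext => s; rewrite (mulHJ_row _ _ _ _ _).1.
  have EU' : (fun s => (U s *m Hmat h1 h2 h3 s *m Jmat R) ord_max ord_max) =
            (fun s => - (u1 s * h1 s + u2 s * h3 s)).
    by apply/funext => s; rewrite (mulHJ_row _ _ _ _ _).2.
  have EV : (fun s => (V s *m Hmat h1 h2 h3 s *m Jmat R) ord_max ord0) =
            (fun s => v1 s * h3 s + v2 s * h2 s).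
    by apply/funext => s; rewrite (mulHJ_row _ _ _ _ _).1.
  have EV' : (fun s => (V s *m Hmat h1 h2 h3 s *m Jmat R) ord_max ord_max) =
            (fun s => - (v1 s * h1 s + v2 s * h3 s)).
    by apply/funext => s; rewrite (mulHJ_row _ _ _ _ _).2.
  have [A1 A2 A3 A4] := S t at_ tb ord_max ord0.
  have [B1 B2 B3 B4] := S t at_ tb ord_max ord_max.
  rewrite -EU -EU' -EV -EV'; split;
    first by split; [exact: A1|exact: B1|exact: A2|exact: B2].
  - by rewrite /u1 A3 !mxE /= add0r.
  - by rewrite /u2 B3 !mxE /=.
  - by rewrite /v1 A4 mulNr.
  - by rewrite /v2 B4 mulNr.
(* At [t = a] the integrals run over one point, so the integral equations yield the initial
   values. *)
have [_ + + + +] := S' a (lexx a) ab.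
rewrite !int_set1 !(mulr0, addr0) => u1a u2a v1a v2a; split=> // T aT Tb.
have tb t : t <= T -> (t%:E < b)%E by move=> tT; apply: le_lt_trans Tb; rewrite lee_fin.
split.
- apply: (@primitive_restrict_off _ (fun s => r * (v1 s * h3 s + v2 s * h2 s))) => //.
  + by move=> t at_ tT; apply: integrable_onZ; have [[]] := S' t at_ (tb t tT).
  + move=> t at_ tT; have [[I _ _ _] E _ _ _] := S' t at_ (tb t tT).
    by rewrite u1a add0r int_Z.
  + by move=> s; rewrite /patch; case: ifP => // _; rewrite !(mulr0, addr0).
- apply: (@primitive_restrict_off _ (fun s => r * - (v1 s * h1 s + v2 s * h3 s))) => //.
  + by move=> t at_ tT; apply: integrable_onZ; have [[]] := S' t at_ (tb t tT).
  + move=> t at_ tT; have [[_ I _ _] _ E _ _] := S' t at_ (tb t tT).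
    by rewrite u2a int_Z.
  + by move=> s; rewrite /patch; case: ifP => // _; rewrite ?(mulr0, addr0)// mulrN mulNr.
- apply: (@primitive_restrict_off _ (fun s => - r * (u1 s * h3 s + u2 s * h2 s))) => //.
  + by move=> t at_ tT; apply: integrable_onZ; have [[]] := S' t at_ (tb t tT).
  + move=> t at_ tT; have [[_ _ I _] _ _ E _] := S' t at_ (tb t tT).
    by rewrite v1a add0r int_Z.
  + by move=> s; rewrite /patch; case: ifP => // _; rewrite !(mulr0, addr0).
- apply: (@primitive_restrict_off _ (fun s => - r * - (u1 s * h1 s + u2 s * h3 s))) => //.
  + by move=> t at_ tT; apply: integrable_onZ; have [[]] := S' t at_ (tb t tT).
  + move=> t at_ tT; have [[_ _ _ I] _ _ _ E] := S' t at_ (tb t tT).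
    by rewrite v2a add0r int_Z.
  + by move=> s; rewrite /patch; case: ifP => // _; rewrite ?(mulr0, addr0)// mulrNN.
Qed.

End OffNullSet.

(** * Passage to the endpoint [b] *)

Section EndPoint.
Set Implicit Arguments.
Unset Strict Implicit.
Variable R : realType.
Variables (a : R) (b : \bar R).
Hypothesis ab : (a%:E < b)%E.

Lemma measurable_fun_Ia_b (g : R -> R) :
  (forall x, Ia_b a b x -> integrable_on a x g) -> measurable_fun (Ia_b a b) g.
Proof.
move=> Ig; have [x [_ xI xE _]] := exhausting_sequence ab.
have -> : Ia_b a b = \bigcup_n `[a, x n]%classic.
  apply/seteqP; split=> [t [at_ tb]|t [n _ /=]].
    by have [n tn] := xE t tb; exists n => //=; rewrite in_itv/= at_.
  rewrite in_itv/= => /andP[at_ tx]; split=> //; have [_] := xI n.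
  by apply: le_lt_trans; rewrite lee_fin.
apply/measurable_fun_bigcup => // n.
by have /Ig/(measurable_int (leb R))/measurable_EFinP := xI n.
Qed.

(** Monotone convergence along an exhausting sequence. The assumption on [F] concerns sequences, so
    that limits along [toward_b] compose with it directly. *)
Lemma integral_Ia_b_lim (g F : R -> R) (l : R) :
  (forall x, Ia_b a b x -> 0 <= g x) ->
  (forall x, Ia_b a b x -> integrable_on a x g) ->
  (forall x, Ia_b a b x -> \int[leb R]_(t in `[a, x]) (g t)%:E = (F x)%:E)%E ->
  (forall x : nat -> R, (forall n, Ia_b a b (x n)) -> x @ \oo --> toward_b b ->
     F \o x @ \oo --> l) ->
  (\int[leb R]_(t in Ia_b a b) (g t)%:E = l%:E)%E.
Proof.
move=> g0 Ig gF Fl; have [x [x_nd xI xE xb]] := exhausting_sequence ab.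
have sub n : `[a, x n] `<=` Ia_b a b.
  move=> t; rewrite /= in_itv/= => /andP[at_ tx]; split=> //; have [_] := xI n.
  by apply: le_lt_trans; rewrite lee_fin.
have E : Ia_b a b = \bigcup_n `[a, x n]%classic.
  apply/seteqP; split=> [t [at_ tb]|t [n _]]; last exact: sub.
  by have [n tn] := xE t tb; exists n => //=; rewrite in_itv/= at_.
have C1 : (\int[leb R]_(t in `[a, x n]) (g t)%:E @[n --> \oo] -->
           \int[leb R]_(t in Ia_b a b) (g t)%:E)%E.
  rewrite E; apply: ge0_nondecreasing_set_cvg_integral => //.
  - by move=> m n mn; apply/subsetPset; apply: subset_itvl; rewrite bnd_simp x_nd.
  - by move=> n; exact: measurable_int (Ig _ (xI n)).
  - by move=> n t /sub tI; rewrite lee_fin g0.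
have C2 : (\int[leb R]_(t in `[a, x n]) (g t)%:E @[n --> \oo] --> l%:E)%E.
  under eq_fun do rewrite gF//.
  by apply: cvg_EFin; [exact: nearW|exact: Fl].
exact: cvg_unique C1 C2.
Qed.

Lemma cvg_ln_cmod (u v : nat -> R) (p q : R) :
  (forall n, 1 <= u n ^+ 2 + v n ^+ 2) -> u @ \oo --> p -> v @ \oo --> q ->
  ln (cmod (u n) (v n)) @[n --> \oo] --> ln (cmod p q).
Proof.
move=> N1 up vq.
have C : u n ^+ 2 + v n ^+ 2 @[n --> \oo] --> p ^+ 2 + q ^+ 2.
  by apply: cvgD; rewrite expr2; [apply: (cvgM up up)|apply: (cvgM vq vq)].
have pq1 : 1 <= p ^+ 2 + q ^+ 2.
  by rewrite -(cvg_lim _ C)//; apply: limr_ge; [apply/cvg_ex; eexists; exact: C|exact: nearW].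
rewrite ln_cmod//; under eq_fun do rewrite ln_cmod//.
apply: cvgM; first exact: cvg_cst.
apply: (cvg_comp _ _ C); apply: continuous_ln; exact: lt_le_trans pq1.
Qed.

End EndPoint.

(** * Integration of the pointwise bounds *)

Theorem theorem3p4 (R : realType) (cm cp : R) :
  0 < cm -> 0 < cp ->
  exists C1 C2 : R, 0 < C1 /\ 0 < C2 /\
  forall (a : R) (b : \bar R) (h1 h2 h3 : R -> R) (r0 : R)
         (that : R -> R) (shat : R -> R -> R) (U V : R -> R -> 'M[R]_2),
    Hamiltonian a b h1 h2 h3 ->
    definite a b h1 h2 h3 ->
    0 <= r0 ->
    compatible_pair a b h1 h2 h3 r0 cm cp that shat ->
    (forall r, r0 < r -> fundamental_solution a b h1 h2 h3 r (U r) (V r)) ->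
    (* x in [a,b) *)
    (forall r x, r0 < r -> a <= x -> (x%:E < b)%E ->
       let L := (ln (cmod (U r x ord_max ord_max) (V r x ord_max ord_max)))%:E in
       let I := (\int[leb R]_(t in `[a, x]) (kernelK a b h1 h2 h3 cp that shat t r)%:E)%E in
       (C1%:E * I <= L <= C2%:E * I)%E) /\
    (* x = b in the limit circle case, W_H(b; ir) = lim_{t -> b} W_H(t; ir) *)
    (limit_circle a b h1 h2 h3 ->
     forall r (u22 v22 : R), r0 < r ->
       (fun t => U r t ord_max ord_max) @ toward_b b --> u22 ->
       (fun t => V r t ord_max ord_max) @ toward_b b --> v22 ->
       let L := (ln (cmod u22 v22))%:E in
       let I := (\int[leb R]_(t in Ia_b a b)
                  (kernelK a b h1 h2 h3 cp that shat t r)%:E)%E in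
       (C1%:E * I <= L <= C2%:E * I)%E).
Proof.
(* The upper constant is that of [bounds_before]; it dominates the [M] of [bounds_after]. *)
move=> cm0 cp0; exists (lower_const cm cp), (cp + (2 + 4 * cp)).
have c1 := lower_const_gt0 cm0 cp0; split=> //.
have c2 : 0 < cp + (2 + 4 * cp) by rewrite addr_gt0// addr_gt0// mulr_gt0.
split=> // a b h1 h2 h3 r0 that shat U V [ab _ Hint [A [mA leA subA]] _] _ r00 cpair sol.
pose G := Iab a b `\` A.
(* [A] is a null set containing every point of [Iab a b] where [H] fails to be nonnegative; off [G]
   the coefficients are [0]. *)
have kpsd x : psd_coef ((h1 \_ G) x) ((h2 \_ G) x) ((h3 \_ G) x).
  rewrite /patch; case: ifPn => [/set_mem [xI nA]|_]; last first.
    by split=> //; rewrite mulr0 expr0n.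
  apply: psd_Hmat; apply: contrapT => np; apply: nA; apply: subA => /= H.
  exact/np/H.
have Ik T : (T%:E < b)%E -> [/\ integrable_on a T (h1 \_ G),
    integrable_on a T (h2 \_ G) & integrable_on a T (h3 \_ G)].
  by move=> Tb; split; apply: integrable_restrict_Iab => // c ac cb;
    have [] := Hint c ac cb.
have kpair := compatible_pair_restrict_off ab mA leA cpair.
have mN := measurable_null_or_left a mA; have leN := leb_null_or_left a mA leA.
pose g r := log_density r (h1 \_ G) (fun t => U r t ord_max ord0)
  (fun t => U r t ord_max ord_max) (fun t => V r t ord_max ord0)
  (fun t => V r t ord_max ord_max).
(* The estimate over an arbitrary [D] in [[a, b)] serves both for [[a, x]] and for [[a, b)]
   itself. *)
have core r : r0 < r -> [/\ (forall x, Ia_b a b x -> 0 <= g r x),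
    (forall x, Ia_b a b x -> integrable_on a x (g r) /\
      (\int[leb R]_(t in `[a, x]) (g r t)%:E =
        (ln (cmod (U r x ord_max ord_max) (V r x ord_max ord_max)))%:E)%E),
    (forall x, Ia_b a b x -> 1 <= U r x ord_max ord_max ^+ 2 + V r x ord_max ord_max ^+ 2) &
    (forall D : set (measurableTypeR R), measurable D -> D `<=` Ia_b a b ->
      (lower_const cm cp)%:E *
        \int[leb R]_(t in D) (kernelK a b h1 h2 h3 cp that shat t r)%:E <=
      \int[leb R]_(t in D) (g r t)%:E <=
      (cp + (2 + 4 * cp))%:E *
        \int[leb R]_(t in D) (kernelK a b h1 h2 h3 cp that shat t r)%:E)%E].
  move=> r0r.
  have [[u1a u2a v1a v2a] S] := fundamental_solution_restrict_off ab mA leA (sol r r0r).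
  have g0 := log_density_ge0 r00 r0r Ik kpsd S u1a u2a v1a v2a.
  have gi := integral_log_density r00 r0r Ik kpsd S u1a u2a v1a v2a.
  have KB := kernel_bounds cm0 cp0 r00 r0r Ik kpsd kpair S u1a u2a v1a v2a.
  split=> //; first exact: (normsq22_ge1_dom r00 r0r Ik kpsd S u1a u2a v1a v2a).
  move=> D mD DI.
  rewrite (eq_integral_off_null (mu := leb R) mN leN
    (f := fun t => (kernelK a b h1 h2 h3 cp that shat t r)%:E)
    (g := fun t => (kernelK a b (h1 \_ G) (h2 \_ G) (h3 \_ G) cp that shat t r)%:E)); last first.
    move=> x /DI xI xN; congr (_%:E).
    exact: (kernelK_restrict_off ab mA leA cpair r0r xI xN).
  apply: (integral_sandwich mN leN mD c1 c2).
  - apply: measurable_funS (measurable_fun_Ia_b ab (fun x xI => (gi x xI).1)) => //.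
    exact: measurable_Ia_b.
  - by move=> x /DI /KB[].
  - by move=> x /DI /g0.
  - by move=> x /DI /KB[_ ? ?]; apply/andP.
split.
  move=> r x r0r ax xb /=; have [_ gi _ bd] := core r r0r.
  rewrite -(gi x (conj ax xb)).2; apply: bd; first exact: measurable_itv.
  move=> t; rewrite /= in_itv/= => /andP[at_ tx]; split=> //.
  by apply: le_lt_trans xb; rewrite lee_fin.
move=> _ r u22 v22 r0r uc vc /=; have [g0 gi N1 bd] := core r r0r.
have <- : (\int[leb R]_(t in Ia_b a b) (g r t)%:E = (ln (cmod u22 v22))%:E)%E.
  apply: (integral_Ia_b_lim ab g0 (fun x xI => (gi x xI).1) (fun x xI => (gi x xI).2)).
  move=> x xI xb; apply: cvg_ln_cmod ; first by move=> n; exact/N1/xI.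
    exact: cvg_comp xb uc.
  exact: cvg_comp xb vc.
by apply: bd => //; exact: measurable_Ia_b.
Qed.
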